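(* Let $\Lambda$ be a compact invariant set of the $C^1$ vector field $X$ on $M$. Suppose that there exist a continuous $DX_t$-invariant decomposition of the tangent bundle $T_{\Lambda}M = E \oplus F$ over $\Lambda$ and constants $C,\lambda > 0$ such that for every $x \in \Lambda$ and all $t>0$ $$\Vert DX_t|_{E_x}\Vert \leq Ce^{-\lambda t}\quad\text{and}\quad \Vert DX_{-t}|_{F_{X_t(x)}}\Vert \le Ce^{-\lambda t}.$$ Then $\Lambda$ consists of finitely many hyperbolic singularities.
   Context: $M$ is a connected compact finite-dimensional Riemannian manifold of dimension $n\ge 3$, with or without boundary; $X$ is inwardly transverse to $\partial M$ if $\partial M\neq\emptyset$; $\{X_t\}$ is the flow generated by $X$, and $DX_t$ its derivative. A set $\Lambda$ is invariant if $X_t(\Lambda)=\Lambda$ for all $t\in\mathbb{R}$. A singularity is a point $\sigma$ with $X(\sigma)=0$; it is hyperbolic if all eigenvalues of $DX(\sigma)$ have nonzero real part. A splitting is $DX_t$-invariant if $DX_t\cdot E_x=E_{X_t(x)}$ and $DX_t\cdot F_x=F_{X_t(x)}$ for all $x\in\Lambda$, $t\in\mathbb{R}$. *)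

(* Defs.v *)
From HB Require Import structures.
From mathcomp Require Import all_boot all_order all_algebra.
From mathcomp Require Import complex.
From mathcomp Require Import all_classical all_reals all_analysis.

Set Implicit Arguments.
Unset Strict Implicit.
Unset Printing Implicit Defensive.

Import Order.TTheory GRing.Theory Num.Theory.
Import numFieldNormedType.Exports.
Local Open Scope classical_set_scope.
Local Open Scope ring_scope.

(* Derivatives are taken relative to a set D, because charts at the boundary
   have images that are only relatively open in a half-space. *)
Definition has_deriv_within (R : realType) (U V : normedModType R)
    (D : set U) (f : U -> V) (a : U) (L : U -> V) : Prop :=
  forall e : R, 0 < e ->
    \forall y \near within D (nbhs a),
      `|f y - f a - L (y - a)| <= e * `|y - a|.

Fixpoint Ck_within (R : realType) (U V : normedModType R) (k : nat)
    (D : set U) (f : U -> V) : Prop :=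
  if k is k'.+1 then
    exists df : U -> {linear U -> V},
      (forall x, D x -> has_deriv_within D f x (df x)) /\
      (forall v : U, Ck_within k' D (fun x => df x v))
  else {within D, continuous f}.

Definition smooth_within (R : realType) (U V : normedModType R)
    (D : set U) (f : U -> V) : Prop :=
  forall k, Ck_within k D f.

(* Matrices act on row vectors from the right: the derivative of f at a is
   v |-> v *m jacobian_within D f a. The value is 0 if f has no derivative
   at a. *)
Definition jacobian_within (R : realType) (n m : nat) (D : set 'rV[R]_n)
    (f : 'rV[R]_n -> 'rV[R]_m) (a : 'rV[R]_n) : 'M[R]_(n, m) :=
  xget 0 [set L | has_deriv_within D f a (fun v => v *m L)].

Definition first_coord (R : realType) (n : nat) (v : 'rV[R]_n) : R :=
  if insub 0%N is Some i then v ord0 i else 0.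

Definition halfspace (R : realType) (n : nat) : set 'rV[R]_n :=
  [set v | 0 <= first_coord v].

(* cmap and cinv are meaningful only on cdom and on cmap @` cdom. *)
Record chart (R : realType) (n : nat) (M : topologicalType) := Chart {
  cdom : set M;
  cmap : M -> 'rV[R]_n;
  cinv : 'rV[R]_n -> M;
  cdom_open : open cdom;
  cimg_open : exists2 O : set 'rV[R]_n, open O &
                cmap @` cdom = O `&` @halfspace R n;
  cmapK : forall x, cdom x -> cinv (cmap x) = x;
  cmap_continuous : {within cdom, continuous cmap};
  cinv_continuous : {within cmap @` cdom, continuous cinv} }.

Section Charts.
Variables (R : realType) (n : nat) (M : topologicalType).
Implicit Types c : chart R n M.

Definition cimg c : set 'rV[R]_n := cmap c @` cdom c.

Definition trans_dom c c' : set 'rV[R]_n := cmap c @` (cdom c `&` cdom c').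

Definition transition c c' : 'rV[R]_n -> 'rV[R]_n := cmap c' \o cinv c.

Definition dtrans c c' (x : M) : 'M[R]_n :=
  jacobian_within (trans_dom c c') (transition c c') (cmap c x).

End Charts.

(* A smooth n-manifold with possibly empty boundary: no chart is required to
   meet the boundary of the half-space. *)
Record smooth_structure (R : realType) (n : nat) (M : topologicalType) :=
  SmoothStructure {
    atlas : set (chart R n M);
    chart_at : M -> chart R n M;
    chart_at_atlas : forall x, atlas (chart_at x);
    chart_at_dom : forall x, cdom (chart_at x) x;
    trans_smooth : forall c c', atlas c -> atlas c' ->
      smooth_within (trans_dom c c') (transition c c') }.

Section Geometry.
Variables (R : realType) (n : nat) (M : topologicalType).
Variable S : smooth_structure R n M.

(* T_x M is 'rV[R]_n, in the coordinates of the distinguished chart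
   chart_at S x; these are turned into the coordinates of a chart c around x
   by to_chart c x. Subspaces of T_x M are row spaces of n x n matrices. *)
Definition to_chart (c : chart R n M) (x : M) : 'M[R]_n :=
  dtrans (chart_at S x) c x.

Definition from_chart (c : chart R n M) (x : M) : 'M[R]_n :=
  dtrans c (chart_at S x) x.

Definition metric_in_chart (g : M -> 'M[R]_n) (c : chart R n M)
    (y : 'rV[R]_n) : 'M[R]_n :=
  from_chart c (cinv c y) *m g (cinv c y) *m (from_chart c (cinv c y))^T.

(* <u, v>_x = u *m g x *m v^T *)
Record riemannian_metric (g : M -> 'M[R]_n) : Prop := RiemannianMetric {
  rmetric_sym : forall x, (g x)^T = g x;
  rmetric_pos : forall x (v : 'rV[R]_n), v != 0 ->
                 0 < (v *m g x *m v^T) ord0 ord0;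
  rmetric_smooth : forall c, atlas S c ->
                    smooth_within (cimg c) (metric_in_chart g c) }.

Definition rnorm (g : M -> 'M[R]_n) (x : M) (v : 'rV[R]_n) : R :=
  Num.sqrt ((v *m g x *m v^T) ord0 ord0).

(* Operator norm of the restriction to W <= T_x M of A : T_x M -> T_y M. *)
Definition opnorm_on (g : M -> 'M[R]_n) (x y : M) (W A : 'M[R]_n) : \bar R :=
  ereal_sup [set (rnorm g y (v *m A))%:E | v in
    [set v : 'rV[R]_n | (v <= W)%MS /\ rnorm g x v <= 1]].

Definition field_in_chart (X : M -> 'rV[R]_n) (c : chart R n M)
    (y : 'rV[R]_n) : 'rV[R]_n :=
  X (cinv c y) *m to_chart c (cinv c y).

Definition C1_vector_field (X : M -> 'rV[R]_n) : Prop :=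
  forall c, atlas S c -> Ck_within 1 (cimg c) (field_in_chart X c).

Definition inwardly_transverse (X : M -> 'rV[R]_n) : Prop :=
  forall c x, atlas S c -> cdom c x -> first_coord (cmap c x) = 0 ->
    0 < first_coord (X x *m to_chart c x).

(* On I, the curve gamma is continuous and gamma'(t) = X (gamma t); the
   derivative is one-sided at the endpoints of I. *)
Definition integral_curve (X : M -> 'rV[R]_n) (I : set R) (gamma : R -> M) :
    Prop :=
  forall t, I t ->
    gamma s @[s --> within I (nbhs t)] --> gamma t /\
    @has_deriv_within R R^o 'rV[R]_n I
      (fun s => cmap (chart_at S (gamma t)) (gamma s)) t
      (fun h => h *: X (gamma t)).

Definition orbit_segment (X : M -> 'rV[R]_n) (t : R) (x : M) (gamma : R -> M) :
    Prop :=
  integral_curve X `[Num.min 0 t, Num.max 0 t] gamma /\ gamma 0 = x.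

(* The domain of X_t. For t < 0 it can be smaller than M, since backward
   orbits leave M through the boundary. *)
Definition flow_dom (X : M -> 'rV[R]_n) (t : R) : set M :=
  [set x | exists gamma, orbit_segment X t x gamma].

(* The value phi t x is constrained only for x in flow_dom X t. *)
Definition flow_of (X : M -> 'rV[R]_n) (phi : R -> M -> M) : Prop :=
  (forall t x, 0 <= t -> flow_dom X t x) /\
  (forall t x gamma, orbit_segment X t x gamma -> phi t x = gamma t).

(* A : T_x M -> T_(f x) M is the derivative at x of f restricted to D. *)
Definition has_tangent_map_within (D : set M) (f : M -> M) (x : M)
    (A : 'M[R]_n) : Prop :=
  f y @[y --> within D (nbhs x)] --> f x /\
  has_deriv_within (cmap (chart_at S x) @` (cdom (chart_at S x) `&` D))
    (cmap (chart_at S (f x)) \o f \o cinv (chart_at S x))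
    (cmap (chart_at S x) x) (fun v => v *m A).

Definition flow_derivative (X : M -> 'rV[R]_n) (phi : R -> M -> M)
    (Dphi : R -> M -> 'M[R]_n) : Prop :=
  forall t x, flow_dom X t x ->
    has_tangent_map_within (flow_dom X t) (phi t) x (Dphi t x).

Definition flow_invariant (X : M -> 'rV[R]_n) (phi : R -> M -> M)
    (Lambda : set M) : Prop :=
  forall t, Lambda `<=` flow_dom X t /\ phi t @` Lambda = Lambda.

(* Around every point of Lambda, E is spanned by a continuous frame B, here
   written in the coordinates of a fixed chart. *)
Definition continuous_subbundle (Lambda : set M) (E : M -> 'M[R]_n) : Prop :=
  forall x, Lambda x ->
    exists (d : nat) (U : set M) (B : M -> 'M[R]_(d, n)),
      [/\ open U, U x, U `<=` cdom (chart_at S x),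
          {within U `&` Lambda, continuous B} &
          forall y, U y -> Lambda y ->
            row_free (B y) /\ (B y == E y *m to_chart (chart_at S x) y)%MS].

Definition continuous_splitting (Lambda : set M) (E F : M -> 'M[R]_n) : Prop :=
  [/\ continuous_subbundle Lambda E,
      continuous_subbundle Lambda F &
      forall x, Lambda x ->
        (E x + F x == 1%:M)%MS /\ mxdirect (E x + F x)%MS].

Definition invariant_subbundle (phi : R -> M -> M) (Dphi : R -> M -> 'M[R]_n)
    (Lambda : set M) (E : M -> 'M[R]_n) : Prop :=
  forall t x, Lambda x -> (E x *m Dphi t x == E (phi t x))%MS.

(* DX(sigma) : T_sigma M -> T_sigma M. At a zero of X the derivative of the
   coordinate expression of X is a chart-independent endomorphism. *)
Definition field_derivative (X : M -> 'rV[R]_n) (sigma : M) : 'M[R]_n :=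
  jacobian_within (cimg (chart_at S sigma)) (field_in_chart X (chart_at S sigma))
    (cmap (chart_at S sigma) sigma).

Definition hyperbolic_singularity (X : M -> 'rV[R]_n) (sigma : M) : Prop :=
  X sigma = 0 /\
  forall z : R[i],
    eigenvalue (map_mx (real_complex R) (field_derivative X sigma)) z ->
    complex.Re z != 0.

End Geometry.

(* Main.v *)
Require Import Defs.
From HB Require Import structures.
From mathcomp Require Import all_boot all_order all_algebra.
From mathcomp Require Import ring lra complex.
From mathcomp Require Import all_classical all_reals all_analysis.

Set Implicit Arguments.
Unset Strict Implicit.
Unset Printing Implicit Defensive.

Import Order.TTheory GRing.Theory Num.Theory.
Import numFieldNormedType.Exports.
Local Open Scope classical_set_scope.
Local Open Scope ring_scope.

(* The field itself is [DX_t]-equivariant: [DX_t X(x) = X(X_t x)]. As [|X|] is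
   bounded on the compact set [Lambda], the [F]-component of [X(x)], expanded in
   forward time, must vanish, and then [X(x)], lying in the contracted bundle
   and having a bounded backward orbit, vanishes too. So [Lambda] consists of
   zeros of [X], none of them on the boundary because [X] points inwards there.
   At such a zero [sigma] with [A = DX(sigma)], a purely imaginary eigenvalue
   yields a complex linear functional [l] with [l \o A = i beta l]; along the
   flow [exp (- i beta t) l] is constant to first order at [sigma], hence
   [l \o DX_t = exp (i beta t) l]. Letting [t] tend to infinity, [l] vanishes on
   [E] (contracted by [DX_t]) and on [F] (contracted by [DX_(-t)]), so [l = 0].
   Hyperbolic zeros have invertible [A], so they are isolated, and [Lambda] is
   compact and discrete, that is, finite. *)

(** * Derivatives relative to a set: chain rule and uniqueness *)

Section Calculus.
Variable R : realType.

Lemma near_within_normP (U : normedModType R) (D : set U) (a : U) (P : U -> Prop) :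
  (\forall y \near within D (nbhs a), P y) <->
  exists2 d : R, 0 < d & forall y, D y -> `|y - a| < d -> P y.
Proof.
rewrite near_withinE; split.
  move=> /nbhs_normP[d /= d0 dP]; exists d => // y Dy ya.
  by apply: dP => //=; rewrite distrC.
move=> [d d0 dP]; apply/nbhs_normP; exists d => //= y ya Dy.
by apply: dP => //; rewrite distrC.
Qed.

Lemma near_normP (U : normedModType R) (a : U) (P : set U) :
  nbhs a P <-> exists2 d : R, 0 < d & forall y, `|y - a| < d -> P y.
Proof.
split.
  by move=> /nbhs_normP[d /= d0 dP]; exists d => // y ya; apply: dP => //=; rewrite distrC.
by move=> [d d0 dP]; apply/nbhs_normP; exists d => //= y ya; apply: dP; rewrite distrC.
Qed.

Lemma has_deriv_withinP (U V : normedModType R) (D : set U) (f : U -> V) a L :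
  has_deriv_within D f a L <->
  forall e : R, 0 < e -> exists2 d : R, 0 < d &
    forall y, D y -> `|y - a| < d -> `|f y - f a - L (y - a)| <= e * `|y - a|.
Proof. by split=> H e e0; apply/near_within_normP; apply: H. Qed.

(** These are the only properties of a derivative that the chain rule uses, and they apply alike to
    [v *m A] and to [h *: v], which are plain functions here. *)
Definition bounded_additive (U V : normedModType R) (L : U -> V) : Prop :=
  (forall u v, L (u - v) = L u - L v) /\
  exists2 K : R, 0 < K & forall v, `|L v| <= K * `|v|.

Lemma coord_norm_le (m n : nat) (B : 'M[R]_(m, n)) i j : `|B i j| <= `|B|.
Proof. rewrite [leRHS]/Num.norm /= mx_normrE; exact: (le_bigmax _ _ (i, j)). Qed.

Lemma mulmx_norm_le (m n p : nat) (u : 'M[R]_(m, n)) (A : 'M[R]_(n, p)) :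
  `|u *m A| <= n%:R * `|u| * `|A|.
Proof.
rewrite [leLHS]/Num.norm /= mx_normrE; apply/bigmax_leP; split=> [|[i j] _ /=].
  by rewrite !mulr_ge0.
rewrite mxE; apply: le_trans (ler_norm_sum _ _ _) _.
have -> : n%:R * `|u| * `|A| = \sum_(k < n) `|u| * `|A|.
  by rewrite sumr_const card_ord -mulrA mulr_natl.
by apply: ler_sum => k _; rewrite normrM ler_pM ?coord_norm_le.
Qed.

Lemma mulmx_bounded_additive (m n : nat) (A : 'M[R]_(n, m)) :
  bounded_additive (fun v : 'rV[R]_n => v *m A).
Proof.
split=> [u v|]; first by rewrite mulmxBl.
exists (n%:R * `|A| + 1) => [|v]; first by rewrite ltr_wpDl // mulr_ge0.
apply: le_trans (mulmx_norm_le _ _) _.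
by rewrite mulrDl mul1r mulrAC lerDl.
Qed.

Lemma scale_bounded_additive (V : normedModType R) (v : V) :
  @bounded_additive R^o V (fun h : R^o => (h : R) *: v).
Proof.
split=> [x y|]; first exact: scalerBl.
exists (`|v| + 1) => [|h]; first by rewrite ltr_wpDl.
by rewrite normrZ mulrC ler_wpM2r // lerDl.
Qed.

Lemma has_deriv_within_lip (U V : normedModType R) (D : set U) (f : U -> V) a L :
  bounded_additive L -> has_deriv_within D f a L ->
  exists2 K : R, 0 < K & exists2 d : R, 0 < d &
    forall y, D y -> `|y - a| < d -> `|f y - f a| <= K * `|y - a|.
Proof.
move=> [_ [K K0 LK]] /has_deriv_withinP/(_ 1 ltr01)[d d0 H].
exists (K + 1); first by rewrite addr_gt0.
exists d => // y Dy ya; rewrite -[X in `|X|](subrK (L (y - a))).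
by rewrite (le_trans (ler_normD _ _)) // addrC mulrDl lerD // H.
Qed.

Lemma has_deriv_within_continuous (U V : normedModType R) (D : set U)
    (f : U -> V) a L :
  bounded_additive L -> has_deriv_within D f a L ->
  f y @[y --> within D (nbhs a)] --> f a.
Proof.
move=> LL /(has_deriv_within_lip LL)[K K0 [d d0 H]].
apply/cvgrPdist_lt => e e0.
apply/near_within_normP; exists (Num.min d (e / K)).
  by rewrite lt_min d0 divr_gt0.
move=> y Dy; rewrite lt_min => /andP[yd ye].
rewrite distrC (le_lt_trans (H _ Dy yd)) //.
by rewrite mulrC -ltr_pdivlMr.
Qed.

Lemma has_deriv_within_comp (U V W : normedModType R) (D : set U) (D' : set V)
    (f : U -> V) (h : V -> W) a L L' :
  bounded_additive L -> bounded_additive L' ->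
  has_deriv_within D f a L -> has_deriv_within D' h (f a) L' ->
  (\forall y \near within D (nbhs a), D' (f y)) ->
  has_deriv_within D (h \o f) a (L' \o L).
Proof.
move=> LL LL' Hf /has_deriv_withinP Hh /near_within_normP[d1 d10 HD].
have [K K0 [d2 d20 HK]] := has_deriv_within_lip LL Hf.
have [Lsub' [K' K'0 LK']] := LL'.
move/has_deriv_withinP: Hf => Hf.
apply/has_deriv_withinP => e e0.
have e1 : 0 < e / 2 / K by rewrite !divr_gt0.
have e2 : 0 < e / 2 / K' by rewrite !divr_gt0.
have [d3 d30 H3] := Hh _ e1.
have [d4 d40 H4] := Hf _ e2.
exists (Num.min (Num.min d1 d2) (Num.min (d3 / K) d4)).
  by rewrite !lt_min d10 d20 d40 divr_gt0.
move=> y Dy; rewrite !lt_min => /andP[/andP[y1 y2] /andP[y3 y4]] /=.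
have fy : `|f y - f a| <= K * `|y - a| := HK _ Dy y2.
have fy3 : `|f y - f a| < d3.
  by rewrite (le_lt_trans fy) // mulrC -ltr_pdivlMr.
have A1 := H3 _ (HD _ Dy y1) fy3.
have A2 := H4 _ Dy y4.
(* The error splits into that of [h] at [f y] and the image under [L'] of that of [f]; each gets
   half of [e]. *)
have -> : h (f y) - h (f a) - L' (L (y - a)) =
   (h (f y) - h (f a) - L' (f y - f a)) + L' (f y - f a - L (y - a)).
  by rewrite (Lsub' (f y - f a)) addrA subrK.
apply: le_trans (ler_normD _ _) _.
have A1' : `|h (f y) - h (f a) - L' (f y - f a)| <= e / 2 * `|y - a|.
  apply: le_trans A1 _.
  have -> : e / 2 * `|y - a| = e / 2 / K * (K * `|y - a|) by field; rewrite gt_eqF.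
  by rewrite ler_wpM2l // ltW.
have A2' : `|L' (f y - f a - L (y - a))| <= e / 2 * `|y - a|.
  apply: le_trans (LK' _) _.
  have -> : e / 2 * `|y - a| = K' * (e / 2 / K' * `|y - a|) by field; rewrite gt_eqF.
  by rewrite ler_wpM2l // ltW.
lra.
Qed.

Lemma has_deriv_within_comp_mx (m n p : nat) (D : set 'rV[R]_m) (D' : set 'rV[R]_n)
    (f : 'rV[R]_m -> 'rV[R]_n) (h : 'rV[R]_n -> 'rV[R]_p) a A B :
  has_deriv_within D f a (fun v => v *m A) ->
  has_deriv_within D' h (f a) (fun v => v *m B) ->
  (\forall y \near within D (nbhs a), D' (f y)) ->
  has_deriv_within D (h \o f) a (fun v => v *m (A *m B)).
Proof.
move=> Hf Hh nD.
have := has_deriv_within_comp (mulmx_bounded_additive _) (mulmx_bounded_additive _) Hf Hh nD.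
by congr has_deriv_within; apply/funext => v /=; rewrite mulmxA.
Qed.

Lemma has_deriv_within_comp_curve (n p : nat) (I : set R) (D : set 'rV[R]_n)
    (f : R -> 'rV[R]_n) (h : 'rV[R]_n -> 'rV[R]_p) t v B :
  @has_deriv_within R R^o _ I f t (fun x => x *: v) ->
  has_deriv_within D h (f t) (fun v => v *m B) ->
  (\forall s \near within I (nbhs t), D (f s)) ->
  @has_deriv_within R R^o _ I (h \o f) t (fun x => x *: (v *m B)).
Proof.
move=> Hf Hh nD.
have := has_deriv_within_comp (scale_bounded_additive _) (mulmx_bounded_additive _) Hf Hh nD.
by congr has_deriv_within; apply/funext => x /=; rewrite scalemxAl.
Qed.

(** Both the set and the function may change, which lets a composite of chart maps be replaced by
    the simpler map that it equals near the point. *)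
Lemma has_deriv_within_near_eq (U V : normedModType R) (D D' : set U)
    (f h : U -> V) a L :
  (\forall y \near within D' (nbhs a), D y /\ f y = h y) -> f a = h a ->
  has_deriv_within D f a L -> has_deriv_within D' h a L.
Proof.
move=> /near_within_normP[d d0 Hd] fh /has_deriv_withinP H.
apply/has_deriv_withinP => e /H[d' d'0 H'].
exists (Num.min d d'); first by rewrite lt_min d0.
move=> y Dy; rewrite lt_min => /andP[y1 y2].
have [Dy' <-] := Hd _ Dy y1.
by rewrite -fh; apply: H'.
Qed.

Lemma has_deriv_within_id (U : normedModType R) (D : set U) (a : U) :
  has_deriv_within D id a id.
Proof.
apply/has_deriv_withinP => e e0; exists 1 => // y _ _.
by rewrite subrr normr0 mulr_ge0 // ltW.
Qed.

(* Only directions along which [D] accumulates at [a] determine a derivative within [D]. *)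
Lemma has_deriv_within_unique (U V : normedModType R) (D : set U) (f : U -> V)
    (a v : U) (L L' : U -> V) :
  (forall h : R, L (h *: v) = h *: L v) ->
  (forall h : R, L' (h *: v) = h *: L' v) ->
  (forall r : R, 0 < r -> exists2 h, 0 < h < r & D (a + h *: v)) ->
  has_deriv_within D f a L -> has_deriv_within D f a L' -> L v = L' v.
Proof.
move=> LZ LZ' Dv /has_deriv_withinP H /has_deriv_withinP H'.
apply/eqP; rewrite -subr_eq0 -normr_eq0; apply/eqP/le_anti/andP; split => //.
apply/ler_addgt0Pl => e e0; rewrite addr0.
pose q := 2 * (`|v| + 1).
have q0 : 0 < q by rewrite mulr_gt0 // ltr_wpDl.
have eq0 : 0 < e / q by rewrite divr_gt0.
have [d d0 Hd] := H _ eq0; have [d' d'0 Hd'] := H' _ eq0.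
have v10 : 0 < `|v| + 1 by rewrite ltr_wpDl.
have m0 : 0 < Num.min d d' / (`|v| + 1) by rewrite divr_gt0 // lt_min d0.
have [h /andP[h0 hlt] Dh] := Dv _ m0.
have hv : `|a + h *: v - a| = h * `|v| by rewrite addrC addKr normrZ gtr0_norm.
have hvlt : h * `|v| < Num.min d d'.
  move: hlt; rewrite ltr_pdivlMr //; apply: le_lt_trans.
  by rewrite ler_wpM2l ?ltW // ltrDl.
move: hvlt; rewrite lt_min => /andP[hd hd'].
have := Hd _ Dh; rewrite hv => /(_ hd); have := Hd' _ Dh; rewrite hv => /(_ hd').
rewrite (_ : a + h *: v - a = h *: v); last by rewrite addrC addKr.
rewrite LZ LZ' => B' B.
have C : `|h *: (L v - L' v)| <= e * h.
  rewrite scalerBr.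
  have -> : h *: L v - h *: L' v =
      (f (a + h *: v) - f a - h *: L' v) - (f (a + h *: v) - f a - h *: L v).
    by rewrite opprB [RHS]addrC addrA subrK.
  apply: le_trans (ler_normB _ _) _; apply: le_trans (lerD B' B) _.
  have -> : e / q * (h * `|v|) + e / q * (h * `|v|) = e * h * (`|v| / (`|v| + 1)).
    by rewrite /q; field; rewrite gt_eqF.
  rewrite ler_piMr ?mulr_ge0 ?ltW //.
  by rewrite ltr_pdivrMr // mul1r ltrDl.
by move: C; rewrite normrZ gtr0_norm // mulrC ler_pM2r.
Qed.

(** An interior point is approached along every basis direction, so all rows of the matrix are
    determined. *)
Lemma has_deriv_within_mx_unique (n m : nat) (D : set 'rV[R]_n)
    (f : 'rV[R]_n -> 'rV[R]_m) a (A B : 'M[R]_(n, m)) :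
  nbhs a D -> has_deriv_within D f a (fun v => v *m A) ->
  has_deriv_within D f a (fun v => v *m B) -> A = B.
Proof.
move=> /near_normP[d d0 Dd] HA HB; apply/row_matrixP => i; rewrite !rowE.
apply: (has_deriv_within_unique (v := delta_mx 0 i) _ _ _ HA HB).
- by move=> h; rewrite scalemxAl.
- by move=> h; rewrite scalemxAl.
move=> r r0; set v := delta_mx 0 i.
have v10 : 0 < `|v| + 1 by rewrite ltr_wpDl.
exists (Num.min (r / 2) (d / (`|v| + 1) / 2)).
  rewrite lt_min !divr_gt0 //= gt_min; apply/orP; left; lra.
apply: Dd; rewrite addrC addKr normrZ gtr0_norm; last by rewrite lt_min !divr_gt0.
set h := Num.min _ _.
have : h <= d / (`|v| + 1) / 2 by rewrite /h ge_min lexx orbT.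
have v0 := normr_ge0 v => hle.
apply: le_lt_trans (_ : d / (`|v| + 1) / 2 * `|v| < d); first by rewrite ler_wpM2r.
have -> : d / (`|v| + 1) / 2 * `|v| = d * (`|v| / (`|v| + 1) / 2) by field; rewrite gt_eqF.
rewrite gtr_pMr // ltr_pdivrMr // ltr_pdivrMr //; lra.
Qed.

Lemma has_deriv_within_curve_unique (V : normedModType R) (b : R) (f : R -> V)
    (u v : V) :
  0 < b ->
  @has_deriv_within R R^o V `[0, b] f 0 (fun h => h *: u) ->
  @has_deriv_within R R^o V `[0, b] f 0 (fun h => h *: v) -> u = v.
Proof.
move=> b0 Hu Hv.
have := @has_deriv_within_unique R^o V `[0, b]%classic f 0 1 _ _ _ _ _ Hu Hv.
rewrite !scale1r; apply.
- by move=> h; rewrite [_%:A]mulr1.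
- by move=> h; rewrite [_%:A]mulr1.
move=> r r0; exists (Num.min b (r / 2)).
  by rewrite lt_min b0 divr_gt0 //= gt_min; apply/orP; right; lra.
rewrite add0r [_%:A]mulr1 /= in_itv /= ge_min lexx andbT.
by rewrite le_min ltW //= divr_ge0 // ltW.
Qed.

End Calculus.

(** * Mean value theorem and Gronwall estimate for curves *)

Section MeanValue.
Variable R : realType.

Lemma within_continuousP (T U : topologicalType) (D : set T) (f : T -> U) :
  {within D, continuous f} <->
  (forall x, D x -> f y @[y --> within D (nbhs x)] --> f x).
Proof.
split=> H.
  move=> x Dx; have := H x; rewrite /continuous_at /=.
  by rewrite /nbhs /= -nbhs_subspace_in.
rewrite continuous_subspace_in => x /set_mem Dx.
by have := H _ Dx; rewrite /continuous_at nbhs_subspace_in.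
Qed.

(** At an interior time of the segment the relative derivative is the two-sided one, which makes the
    mean value theorem available. *)
Lemma has_deriv_within_is_derive (b s c : R) (f : R -> R) : 0 < s < b ->
  @has_deriv_within R R^o R^o `[0, b] f s (fun h => h *: c) ->
  is_derive s (1 : R) f c.
Proof.
move=> /andP[s0 sb] /has_deriv_withinP H.
have cv : h^-1 *: (f (h *: 1 + s) - f s) @[h --> 0^'] --> c.
  apply/cvgrPdist_lt => e e0.
  have e20 : 0 < e / 2 by rewrite divr_gt0.
  have [d d0 Hd] := H _ e20.
  apply/near_within_normP; exists (Num.min d (Num.min s (b - s))).
    by rewrite !lt_min d0 s0 subr_gt0 sb.
  move=> h /= hne0; rewrite subr0 !lt_min => /andP[hd /andP[hs hbs]].
  rewrite [h *: 1]mulr1.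
  have hI : `[0, b]%classic (h + s).
    rewrite /= in_itv /=; move: hs hbs; rewrite !ltr_norml => /andP[h1 _] /andP[_ h2].
    by apply/andP; split; lra.
  have := Hd _ hI; rewrite addrK => /(_ hd) B.
  rewrite distrC -[X in _ - X](scalerK hne0) -scalerBr normrZ normfV.
  rewrite ltr_pdivrMl ?normr_gt0 // mulrC.
  apply: le_lt_trans B _; rewrite ltr_pM2r ?normr_gt0 //; lra.
split; first by apply/cvg_ex; exists c; exact: cv.
exact: cvg_lim cv.
Qed.

Lemma is_derive_within_mvt (b : R) (f d : R -> R) : 0 <= b ->
  (forall s, 0 < s < b -> is_derive s (1 : R) f (d s)) ->
  (forall s, `[0, b]%classic s -> f y @[y --> within `[0, b] (nbhs s)] --> f s) ->
  exists2 s, 0 <= s <= b & f b - f 0 = d s * b.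
Proof.
move=> b0 Hd Hc.
have [c cI E] : exists2 c : R, c \in `[0, b] & f b - f 0 = d c * (b - 0).
  by apply: MVT_segment => //; exact/within_continuousP.
move: E cI; rewrite subr0 in_itv /= => E cI; by exists c.
Qed.

Variable n : nat.
Implicit Types gamma dgamma : R -> 'rV[R]_n.

Definition curve_derivative b gamma dgamma :=
  forall s, `[0, b]%classic s ->
    @has_deriv_within R R^o 'rV[R]_n `[0, b] gamma s (fun h => h *: dgamma s).

Lemma curve_coord_is_derive b gamma dgamma (u : 'cV[R]_n) s : 0 < s < b ->
  curve_derivative b gamma dgamma ->
  is_derive s (1 : R) (fun x => (gamma x *m u) 0 0) ((dgamma s *m u) 0 0).
Proof.
move=> sb H; apply: (has_deriv_within_is_derive sb).
have sI : `[0, b]%classic s.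
  by rewrite /= in_itv /=; move: sb => /andP[/ltW -> /ltW ->].
move/has_deriv_withinP: (H _ sI) => Hs; apply/has_deriv_withinP => e e0.
have u0 : 0 < n%:R * `|u| + 1 by rewrite ltr_wpDl // mulr_ge0.
have [d d0 Hd] := Hs _ (divr_gt0 e0 u0); exists d => // y Dy yd.
have := Hd _ Dy yd; set w := _ - _ - _ => W.
have -> : (gamma y *m u) 0 0 - (gamma s *m u) 0 0 - (y - s) *: (dgamma s *m u) 0 0
   = (w *m u) 0 0 by rewrite /w !mulmxBl -scalemxAl !mxE.
apply: le_trans (coord_norm_le _ _ _) _; apply: le_trans (mulmx_norm_le _ _) _.
rewrite mulrAC; apply: le_trans (ler_wpM2l _ W) _; first by rewrite mulr_ge0.
rewrite mulrA ler_wpM2r // mulrA [_ * e]mulrC -mulrA ler_piMr ?ltW //.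
by rewrite ltr_pdivrMr // mul1r ltrDl.
Qed.

Lemma curve_continuous b gamma dgamma : curve_derivative b gamma dgamma ->
  forall s, `[0, b]%classic s ->
    gamma y @[y --> within `[0, b] (nbhs s)] --> gamma s.
Proof.
move=> H s /H; apply: has_deriv_within_continuous.
exact: scale_bounded_additive.
Qed.

Lemma curve_coord_continuous b gamma dgamma (u : 'cV[R]_n) :
  curve_derivative b gamma dgamma ->
  forall s, `[0, b]%classic s ->
    (gamma y *m u) 0 0 @[y --> within `[0, b] (nbhs s)] --> (gamma s *m u) 0 0.
Proof.
move=> /curve_continuous H s /H /cvgrPdist_lt Hs; apply/cvgrPdist_lt => e e0.
have u0 : 0 < n%:R * `|u| + 1 by rewrite ltr_wpDl // mulr_ge0.
have := Hs _ (divr_gt0 e0 u0); apply: filterS => y /= W.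
have -> : (gamma s *m u) 0 0 - (gamma y *m u) 0 0 = ((gamma s - gamma y) *m u) 0 0.
  by rewrite mulmxBl !mxE.
apply: le_lt_trans (coord_norm_le _ _ _) _; apply: le_lt_trans (mulmx_norm_le _ _) _.
rewrite mulrAC; move: W; rewrite ltr_pdivlMr // mulrDr mulr1 mulrC.
by apply: le_lt_trans; rewrite lerDl.
Qed.

(** The matrix norm is the maximum norm, which is not differentiable; the Gronwall argument runs on
    the Euclidean square instead, comparable to the squared norm up to a factor [n]. *)
Let sqn (w : 'rV[R]_n) : R := \sum_i (w 0 i) ^+ 2.

Let sqn_ge (w : 'rV[R]_n) : `|w| ^+ 2 <= sqn w.
Proof.
rewrite -[`|w|]/(mx_norm w); have [->|/mx_norm_neq0] := eqVneq (mx_norm w) 0.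
  by rewrite expr0n sumr_ge0 // => i _; rewrite sqr_ge0.
case=> -[i j] ->; rewrite /= real_normK ?num_real // ord1.
by rewrite /sqn (bigD1 j) //= lerDl sumr_ge0 // => k _; rewrite sqr_ge0.
Qed.

Let sqn_le (w : 'rV[R]_n) : sqn w <= n%:R * `|w| ^+ 2.
Proof.
apply: le_trans (ler_sum _ (G := fun=> `|w| ^+ 2) _) _.
  move=> i _; rewrite -[leLHS]real_normK ?num_real //.
  by rewrite ler_pXn2r ?nnegrE // coord_norm_le.
by rewrite sumr_const card_ord mulr_natl.
Qed.

(* Gronwall, by the monotonicity of [exp (- 2 n L s) * sum_i (gamma_i s)^2]. *)
Lemma gronwall b gamma dgamma (L : R) : 0 <= b -> 0 <= L ->
  curve_derivative b gamma dgamma ->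
  (forall s, 0 <= s <= b -> `|dgamma s| <= L * `|gamma s|) ->
  `|gamma b| <= n%:R * expR (n%:R * L * b) * `|gamma 0|.
Proof.
move=> b0 L0 H HL.
(* The derivative of the Euclidean square is at most [2 n L] times the squared maximum norm, hence
   at most [K] times the Euclidean square itself. *)
pose K := 2 * (n%:R * L).
pose co i s := (gamma s *m (delta_mx i 0 : 'cV_n)) 0 0.
have coE i s : co i s = gamma s 0 i by rewrite /co -colE mxE.
pose f (s : R) := (\sum_i (co i s) ^+ 2) * expR (- K * s).
pose d (s : R) := (\sum_i 2 * (gamma s 0 i * dgamma s 0 i)) * expR (- K * s)
   - (\sum_i (gamma s 0 i) ^+ 2) * (K * expR (- K * s)).
have [s sb|s sI|c cb E] := @is_derive_within_mvt b f d b0.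
- have D1 i : is_derive s (1 : R) (co i) (dgamma s 0 i).
    by have := curve_coord_is_derive (delta_mx i 0) sb H; rewrite -colE [in X in X -> _]mxE.
  have fE : f = (\sum_i (co i) ^+ 2) * (expR \o ( *%R (- K))).
    by apply/funext => x /=; rewrite fct_sumE.
  rewrite fE; apply: is_derive_eq.
  rewrite /d /GRing.scale /= fct_sumE [X in _ + X]mulrC addrC; congr (_ + _).
    congr (_ * _); apply: eq_bigr => i _; rewrite coE expr1.
    by rewrite mulrA.
  rewrite mulr1 -[RHS]mulrN; congr (_ * _); last by rewrite mulrC mulNr.
  by apply: eq_bigr => i _; rewrite -coE.
- apply: cvgM.
    apply: cvg_big => [|i _]; first exact: add_continuous.
    apply: cvgM; exact: curve_coord_continuous H _ sI.
  apply: cvg_within_filter; apply: continuous_cvg; first exact: continuous_expR.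
  by apply: cvgM; [exact: cvg_cst|exact: cvg_id].
have dc0 : d c <= 0.
  rewrite /d mulrA -mulrBl mulr_le0_ge0 ?expR_ge0 // subr_le0.
  apply: le_trans (_ : \sum_(i < n) 2 * (L * `|gamma c| ^+ 2) <= _).
    apply: ler_sum => i _; rewrite ler_pM2l // (le_trans (ler_norm _)) // normrM.
    rewrite mulrC expr2 mulrA ler_pM ?coord_norm_le //.
    by apply: le_trans (coord_norm_le _ _ _) _; rewrite ?HL.
  rewrite sumr_const card_ord (_ : _ *+ n = K * `|gamma c| ^+ 2).
    rewrite mulrC ler_wpM2r ?sqn_ge //; by rewrite !mulr_ge0.
  by rewrite -[LHS]mulr_natr /K; ring.
have fb : f b <= f 0 by rewrite -subr_le0 E mulr_le0_ge0.
have fE s : f s = sqn (gamma s) * expR (- K * s).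
  by congr (_ * _); apply: eq_bigr => i _; rewrite coE.
move: fb; rewrite !fE mulr0 expR0 mulr1 mulNr expRN.
rewrite ler_pdivrMr ?expR_gt0 // => B.
rewrite -ler_sqr ?nnegrE ?mulr_ge0 ?expR_ge0 //.
apply: le_trans (sqn_ge _) _; apply: le_trans B _.
rewrite !exprMn -expRM_natl mulrAC.
have -> : 2%:R * (n%:R * L * b) = K * b by rewrite /K; ring.
rewrite ler_wpM2r ?expR_ge0 //.
apply: le_trans (sqn_le _) _; rewrite ler_wpM2r ?sqr_ge0 //.
(* The target was squared, so its factor is [n ^ 2], which dominates the [n] coming from
   [sqn_le]. *)
by rewrite -natrX ler_nat; case: (n) => // k; rewrite expnS leq_pmulr // expn_gt0.
Qed.

End MeanValue.

(** * The Riemannian norm on tangent spaces *)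

Section InnerProduct.
Variables (R : realType) (n : nat) (M : topologicalType).
Variables (S : smooth_structure R n M) (g : M -> 'M[R]_n).
Hypothesis g_metric : riemannian_metric S g.
Implicit Types (x y : M) (u v w : 'rV[R]_n).

Let ip x u v : R := (u *m g x *m v^T) 0 0.

Let ipC x u v : ip x u v = ip x v u.
Proof.
rewrite /ip -[in LHS](trmxK (u *m g x *m v^T)) [LHS]mxE.
by rewrite !trmx_mul trmxK (rmetric_sym g_metric) mulmxA.
Qed.

Let ipDl x u v w : ip x (u + v) w = ip x u w + ip x v w.
Proof. by rewrite /ip !mulmxDl mxE. Qed.

Let ipZl x h u w : ip x (h *: u) w = h * ip x u w.
Proof. by rewrite /ip -!scalemxAl mxE. Qed.

Let ipDr x u v w : ip x w (u + v) = ip x w u + ip x w v.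
Proof. by rewrite ipC ipDl !(ipC _ w). Qed.

Let ipZr x h u w : ip x w (h *: u) = h * ip x w u.
Proof. by rewrite ipC ipZl (ipC _ w). Qed.

Let ip_ge0 x v : 0 <= ip x v v.
Proof.
have [->|/(rmetric_pos g_metric x)/ltW//] := eqVneq v 0.
by rewrite /ip !mul0mx mxE.
Qed.

Lemma rnorm_ge0 x v : 0 <= rnorm g x v.
Proof. exact: sqrtr_ge0. Qed.

Let rnorm_sqr x v : rnorm g x v ^+ 2 = ip x v v.
Proof. by rewrite sqr_sqrtr // ip_ge0. Qed.

Lemma rnorm_gt0 x v : v != 0 -> 0 < rnorm g x v.
Proof. by move=> v0; rewrite sqrtr_gt0 (rmetric_pos g_metric). Qed.

Lemma rnorm_le0 x v : rnorm g x v <= 0 -> v = 0.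
Proof. by move=> v0; apply/eqP; apply: contraTT v0 => /rnorm_gt0 v0; rewrite -ltNge. Qed.

Lemma rnorm0 x : rnorm g x 0 = 0.
Proof. by rewrite /rnorm !mul0mx mxE sqrtr0. Qed.

Lemma rnormZ x (h : R) v : rnorm g x (h *: v) = `|h| * rnorm g x v.
Proof.
rewrite /rnorm -[_ 0 0]/(ip x (h *: v) (h *: v)) ipZl ipZr mulrA -expr2.
by rewrite sqrtrM ?sqr_ge0 // sqrtr_sqr.
Qed.

Let cauchy_schwarz x u v : `|ip x u v| <= rnorm g x u * rnorm g x v.
Proof.
have [->|v0] := eqVneq v 0.
  by rewrite rnorm0 mulr0 ipC /ip !mul0mx mxE normr0.
rewrite -ler_sqr ?nnegrE ?mulr_ge0 ?rnorm_ge0 // exprMn !rnorm_sqr.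
rewrite real_normK ?num_real //.
have b0 : 0 < ip x v v by exact: (rmetric_pos g_metric).
(* The vector is [<v,v> u - <u,v> v]; its square expands to [<v,v>] times the difference of the two
   sides. *)
have := ip_ge0 x (ip x v v *: u + (- ip x u v) *: v).
rewrite !(ipDl, ipDr, ipZl, ipZr) (ipC x v u) => H.
rewrite -subr_ge0 -(pmulr_rge0 _ b0).
by apply: le_trans H _; rewrite le_eqVlt; apply/orP; left; apply/eqP; ring.
Qed.

Lemma rnormD x u v : rnorm g x (u + v) <= rnorm g x u + rnorm g x v.
Proof.
rewrite -ler_sqr ?nnegrE ?addr_ge0 ?rnorm_ge0 // rnorm_sqr sqrrD !rnorm_sqr.
rewrite ipDl !ipDr (ipC x v u).
have := le_trans (ler_norm _) (cauchy_schwarz x u v).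
rewrite mulr2n; lra.
Qed.

Lemma rnormN x v : rnorm g x (- v) = rnorm g x v.
Proof. by rewrite -scaleN1r rnormZ normrN1 mul1r. Qed.

(** Normalizing [v] puts it in the unit ball over which the supremum is taken; the zero vector is
    treated apart. *)
Lemma rnorm_opnorm x y (W A : 'M[R]_n) (c : R) v :
  (opnorm_on g x y W A <= c%:E)%E -> (v <= W)%MS ->
  rnorm g y (v *m A) <= c * rnorm g x v.
Proof.
move=> H vW; have [->|v0] := eqVneq v 0; first by rewrite mul0mx !rnorm0 mulr0.
have r0 := rnorm_gt0 x v0.
have : ((rnorm g y ((rnorm g x v)^-1 *: v *m A))%:E <= c%:E)%E.
  apply: le_trans H; apply: ereal_sup_ubound; exists ((rnorm g x v)^-1 *: v) => //.
  split; first exact: scalemx_sub.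
  by rewrite rnormZ gtr0_norm ?invr_gt0 // mulVf // gt_eqF.
by rewrite lee_fin -scalemxAl rnormZ gtr0_norm ?invr_gt0 // ler_pdivrMl // mulrC.
Qed.

(** Positive definiteness makes [g x] invertible, so the functional is the inner product with the
    transpose of [invmx (g x) *m a]; by Cauchy-Schwarz the norm of that vector serves as [K]. *)
Lemma rnorm_functional x (a : 'cV[R]_n) :
  exists2 K : R, 0 <= K & forall v, `|(v *m a) 0 0| <= K * rnorm g x v.
Proof.
have gU : g x \in unitmx.
  rewrite -row_free_unit; apply/inj_row_free => v /(congr1 (fun w => (w *m v^T) 0 0)).
  rewrite mul0mx [X in _ = X]mxE => E; apply/eqP; apply: contra_eqT E => v0.
  by rewrite gt_eqF // (rmetric_pos g_metric).
exists (rnorm g x (invmx (g x) *m a)^T) => [|v]; first exact: rnorm_ge0.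
have := cauchy_schwarz x v (invmx (g x) *m a)^T.
by rewrite /ip trmxK -mulmxA mulKVmx // mulrC.
Qed.

End InnerProduct.

(** * Coordinate changes and integral curves in charts *)

Section ChartCalculus.
Variables (R : realType) (n : nat) (M : topologicalType).
Implicit Type c : chart R n M.

Lemma near_cinv c x (U : set M) : cdom c x -> nbhs x U ->
  \forall z \near within (cimg c) (nbhs (cmap c x)),
    [/\ U (cinv c z), cdom c (cinv c z) & cmap c (cinv c z) = z].
Proof.
move=> cx Ux.
have ix : cimg c (cmap c x) by exists x.
have := (within_continuousP _ _).1 (@cinv_continuous _ _ _ c) _ ix.
rewrite (cmapK cx) => H.
have nU : \forall z \near within (cimg c) (nbhs (cmap c x)), U (cinv c z) := H _ Ux.
rewrite !near_withinE in nU *; apply: filterS nU => z Uz iz.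
have [y cy yz] := iz.
have yE : cinv c z = y by rewrite -yz cmapK.
by split; [exact: Uz|rewrite yE|rewrite yE].
Qed.

Lemma nbhs_cmap_image c x (U : set M) : cdom c x -> nbhs (cmap c x) (cimg c) ->
  nbhs x U -> nbhs (cmap c x) (cmap c @` (cdom c `&` U)).
Proof.
move=> cx ix /(near_cinv cx); rewrite near_withinE.
apply: filterS2 ix => z iz /(_ iz)[Uz cz <-]; by exists (cinv c z).
Qed.

Lemma near_cdom c x : cdom c x -> nbhs x (cdom c).
Proof. by move=> cx; apply: open_nbhs_nbhs; split => //; exact: cdom_open. Qed.

Variable S : smooth_structure R n M.

(** Smoothness of order 1 supplies a derivative, so at points common to both charts [dtrans] is not
    the default value of [jacobian_within]. *)
Lemma transition_deriv c c' x : atlas S c -> atlas S c' ->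
  cdom c x -> cdom c' x ->
  has_deriv_within (trans_dom c c') (transition c c') (cmap c x)
    (fun v => v *m dtrans c c' x).
Proof.
move=> ac ac' cx cx'.
have [df [Hdf _]] := trans_smooth ac ac' 1%N.
have tx : trans_dom c c' (cmap c x) by exists x.
rewrite /dtrans /jacobian_within.
apply: (@xgetPex _ 0 [set L | has_deriv_within (trans_dom c c') (transition c c')
    (cmap c x) (fun v => v *m L)]).
exists (lin1_mx (df (cmap c x))) => /=.
rewrite (_ : (fun v => _) = df (cmap c x)); first exact: Hdf.
by apply/funext => v; rewrite mul_rV_lin1.
Qed.

(** The two transition maps compose to the identity, and at an interior point the derivative of the
    identity is unique. *)
Lemma to_from_chart c x : atlas S c -> cdom c x ->
  nbhs (cmap (chart_at S x) x) (cimg (chart_at S x)) ->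
  to_chart S c x *m from_chart S c x = 1%:M.
Proof.
move=> ac cx ix; set c0 := chart_at S x.
have c0x : cdom c0 x := chart_at_dom S x.
have ac0 : atlas S c0 := chart_at_atlas S x.
have tK y : trans_dom c0 c y ->
    cinv c (transition c0 c y) = cinv c0 y /\ transition c c0 (transition c0 c y) = y.
  by move=> [p [c0p cp] <-]; rewrite /transition /= !cmapK.
have tx : transition c0 c (cmap c0 x) = cmap c x by rewrite /transition /= cmapK.
apply: (@has_deriv_within_mx_unique _ _ _ (trans_dom c0 c) id (cmap c0 x)).
- exact: nbhs_cmap_image (near_cdom cx).
- have H1 := transition_deriv ac0 ac c0x cx.
  have H2 := transition_deriv ac ac0 cx c0x.
  rewrite -tx in H2.
  have nD : \forall z \near within (trans_dom c0 c) (nbhs (cmap c0 x)),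
      trans_dom c c0 (transition c0 c z).
    rewrite near_withinE; apply: nearW => z [p [c0p cp] <-].
    by exists p => //; rewrite /transition /= cmapK.
  have := has_deriv_within_comp_mx H1 H2 nD.
  apply: has_deriv_within_near_eq.
    by rewrite near_withinE; apply: nearW => z tz; split => //; case: (tK _ tz).
  by rewrite /= /transition /= !cmapK.
- rewrite (_ : (fun v => _) = id); first exact: has_deriv_within_id.
  by apply/funext => v; rewrite mulmx1.
Qed.

Variable X : M -> 'rV[R]_n.

(** An integral curve is differentiated in the distinguished chart at each of its points, a chart
    that may vary with time; the chain rule with the transition map carries this to one fixed
    chart. *)
Lemma integral_curve_chart (I : set R) (gamma : R -> M) t c :
  integral_curve S X I gamma -> I t -> atlas S c -> cdom c (gamma t) ->
  @has_deriv_within R R^o 'rV[R]_n I (cmap c \o gamma) t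
    (fun h => h *: (X (gamma t) *m to_chart S c (gamma t))).
Proof.
move=> H It ac ct; have [Hc Hd] := H _ It.
set x := gamma t in ct Hc Hd *; set c0 := chart_at S x in Hd *.
have c0x : cdom c0 x := chart_at_dom S x.
have ac0 : atlas S c0 := chart_at_atlas S x.
have near0 : \forall s \near within I (nbhs t), cdom c0 (gamma s) := Hc _ (near_cdom c0x).
have near1 : \forall s \near within I (nbhs t), cdom c (gamma s) := Hc _ (near_cdom ct).
have H1 : has_deriv_within (trans_dom c0 c) (transition c0 c) (cmap c0 (gamma t)) _ :=
  transition_deriv ac0 ac c0x ct.
have nD : \forall s \near within I (nbhs t), trans_dom c0 c (cmap c0 (gamma s)).
  by apply: filterS2 near0 near1 => s c0s cs; exists (gamma s).
have := has_deriv_within_comp_curve Hd H1 nD.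
apply: has_deriv_within_near_eq; last by rewrite /= /transition /= cmapK.
rewrite near_withinE in near0 *; apply: filterS near0 => s c0s Is.
by split => //=; rewrite /transition /= cmapK //; exact: c0s.
Qed.

Lemma integral_curve_shift (I I' : set R) (gamma : R -> M) t :
  integral_curve S X I gamma -> (forall s, I' s -> I (t + s)) ->
  integral_curve S X I' (fun s => gamma (t + s)).
Proof.
move=> H II' s I's; have [Hc /has_deriv_withinP Hd] := H _ (II' _ I's); split.
  move=> U /Hc nU; have {}nU : \forall u \near within I (nbhs (t + s)), U (gamma u) := nU.
  have [d d0 dU] := (@near_within_normP R R^o _ _ _).1 nU.
  apply: ((@near_within_normP R R^o I' s (fun u => U (gamma (t + u)))).2).
  exists d => // y I'y ys; apply: dU; first exact: II'.
  by rewrite opprD addrACA subrr add0r.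
apply/has_deriv_withinP => e /Hd[d d0 dU]; exists d => // y I'y ys.
have := dU _ (II' _ I'y); rewrite opprD addrACA subrr add0r.
exact.
Qed.

Lemma integral_curve_sub (I I' : set R) (gamma : R -> M) :
  integral_curve S X I gamma -> I' `<=` I -> integral_curve S X I' gamma.
Proof.
move=> H II'.
have -> : gamma = fun s => gamma (0 + s) by apply/funext => s; rewrite add0r.
by apply: integral_curve_shift H _ => s; rewrite add0r; exact: II'.
Qed.

End ChartCalculus.

(** * The flow and its derivative *)

Section Flow.
Variables (R : realType) (n : nat) (M : topologicalType).
Variables (S : smooth_structure R n M) (X : M -> 'rV[R]_n).
Variables (phi : R -> M -> M) (DX : R -> M -> 'M[R]_n).
Hypothesis phi_flow : flow_of S X phi.
Hypothesis DX_deriv : flow_derivative S X phi DX.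

Let segE (t : R) : 0 <= t -> `[Num.min 0 t, Num.max 0 t]%classic = `[0, t]%classic.
Proof. by move=> t0; rewrite min_l // max_r. Qed.

Let segNE (t : R) : 0 <= t ->
  `[Num.min 0 (- t), Num.max 0 (- t)]%classic = `[- t, 0]%classic.
Proof. by move=> t0; rewrite min_r ?oppr_le0 // max_l // oppr_le0. Qed.

Lemma flow_curve t x : 0 <= t -> exists gamma,
  [/\ integral_curve S X `[0, t] gamma, gamma 0 = x &
      forall s, 0 <= s <= t -> phi s x = gamma s].
Proof.
move=> t0; have [gamma [H g0]] := phi_flow.1 t x t0.
rewrite segE // in H; exists gamma; split => // s /andP[s0 st].
apply: phi_flow.2; split => //; rewrite segE //.
apply: integral_curve_sub H _ => u /=; rewrite !in_itv /= => /andP[-> us].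
exact: le_trans us st.
Qed.

Lemma flow_shift a t x gamma : 0 <= a -> 0 <= t ->
  integral_curve S X `[0, a + t] gamma -> gamma 0 = x ->
  phi t (gamma a) = gamma (a + t).
Proof.
move=> a0 t0 H g0; apply: (phi_flow.2 t (gamma a) (fun s => gamma (a + s))).
split; last by rewrite addr0.
rewrite segE //; apply: integral_curve_shift H _ => s /=.
by rewrite !in_itv /= lerD2l => /andP[s0 ->]; rewrite addr_ge0.
Qed.

(** The backward flow need not be defined everywhere, but at [phi t x] the forward orbit of [x],
    translated in time by [t], is a backward orbit segment. *)
Lemma flow_back t x : 0 <= t ->
  flow_dom S X (- t) (phi t x) /\ phi (- t) (phi t x) = x.
Proof.
move=> t0; have [gamma [H g0 Hg]] := flow_curve x t0.
have -> : phi t x = gamma t by rewrite Hg // t0 lexx.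
have seg : orbit_segment S X (- t) (gamma t) (fun s => gamma (t + s)).
  split; last by rewrite addr0.
  rewrite segNE //; apply: integral_curve_shift H _ => s /=.
  by rewrite !in_itv /= => /andP[s1 s2]; apply/andP; split; lra.
split; first by exists (fun s => gamma (t + s)).
by rewrite (phi_flow.2 _ _ _ seg) subrr.
Qed.

Lemma flow_fixed t x : X x = 0 -> phi t x = x.
Proof.
move=> Xx; apply: (phi_flow.2 t x (fun=> x)); split => // s _; split.
  exact: cvg_cst.
apply/has_deriv_withinP => e e0; exists 1 => // y _ _.
by rewrite Xx scaler0 !subr0 subrr normr0 mulr_ge0 // ltW.
Qed.

Let flow_domT t x : 0 <= t -> flow_dom S X t x.
Proof. exact: phi_flow.1. Qed.

(** This is the chain rule for [phi (- t) \o phi t = id], read in the charts at [x] and [phi t x];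
    as [x] is interior, the derivative of the identity is unique. *)
Lemma flow_derivative_inverse t x : 0 <= t ->
  nbhs (cmap (chart_at S x) x) (cimg (chart_at S x)) ->
  DX t x *m DX (- t) (phi t x) = 1%:M.
Proof.
move=> t0 ix; have [fd back] := flow_back x t0.
have [C1 D1] := DX_deriv (flow_domT x t0).
have [C2 D2] := DX_deriv fd; rewrite back in C2 D2.
set cx := chart_at S x in ix D1 D2 *; set cy := chart_at S (phi t x) in D1 D2.
have cxx : cdom cx x := chart_at_dom S x.
have cyy : cdom cy (phi t x) := chart_at_dom S (phi t x).
have dT : [set: M] = flow_dom S X t.
  by apply/seteqP; split => // y _; exact: flow_domT.
rewrite -dT setIT in D1; rewrite -dT withinET in C1.
have nU := near_cinv cxx (C1 _ (near_cdom cyy)).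
set f1 := cmap cy \o _ \o _ in D1; set f2 := cmap cx \o _ \o _ in D2.
have f1x : cmap cy (phi t x) = f1 (cmap cx x) by rewrite /f1 /= cmapK.
rewrite f1x in D2.
have nD : \forall z \near within (cimg cx) (nbhs (cmap cx x)),
    (cmap cy @` (cdom cy `&` flow_dom S X (- t))) (f1 z).
  apply: filterS nU => z [/= cyz cxz zE].
  by exists (phi t (cinv cx z)) => //; split => //; case: (flow_back (cinv cx z) t0).
have := has_deriv_within_comp_mx D1 D2 nD.
move=> H; apply: (@has_deriv_within_mx_unique _ _ _ (cimg cx) id (cmap cx x)) => //.
- apply: has_deriv_within_near_eq H.
    rewrite near_withinE; rewrite near_withinE in nU.
    apply: filterS nU => z nz iz; split => //; have [/= cyz cxz zE] := nz iz.
    by rewrite /f1 /f2 /= cmapK // (flow_back _ t0).2.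
  by rewrite /f1 /f2 /= cmapK // cmapK // back.
- rewrite (_ : (fun v => _) = id); first exact: has_deriv_within_id.
  by apply/funext => v; rewrite mulmx1.
Qed.

(** Both sides are the right derivative at [s = 0] of the curve [phi (t + s) x], which is also
    [phi t (phi s x)]. *)
Lemma flow_derivative_field t x : 0 <= t -> X x *m DX t x = X (phi t x).
Proof.
(* One unit of time beyond [t] leaves room for a right derivative at [t]. *)
move=> t0; have t1 : 0 <= t + 1 by rewrite addr_ge0.
have [gamma [H g0 Hg]] := flow_curve x t1.
have gt : phi t x = gamma t by rewrite Hg // t0 lerDl ler01.
have I0 : `[0, 1]%classic (0 : R) by rewrite /= in_itv /= lexx ler01.
have H0 : integral_curve S X `[0, 1] gamma.
  apply: integral_curve_sub H _ => s /=; rewrite !in_itv /= => /andP[-> s1].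
  by rewrite (le_trans s1) ?lerDr.
have Ht : integral_curve S X `[0, 1] (fun s => gamma (t + s)).
  apply: integral_curve_shift H _ => s /=; rewrite !in_itv /= => /andP[s0 s1].
  by rewrite addr_ge0 // lerD2l.
have [C1 D1] := DX_deriv (flow_domT x t0).
have [C0 D0] := H0 _ I0; rewrite g0 in C0 D0.
have [Ct Dt] := Ht _ I0; rewrite addr0 -gt in Ct Dt.
set cx := chart_at S x in D1 D0; set cy := chart_at S (phi t x) in D1 Dt.
have cxx : cdom cx x := chart_at_dom S x.
have dT : [set: M] = flow_dom S X t.
  by apply/seteqP; split => // y _; exact: flow_domT.
rewrite -dT setIT in D1.
set f1 := cmap cy \o _ \o _ in D1.
rewrite -g0 in D1; rewrite -/(cimg cx) in D1.
have near0 : \forall s \near within `[0, 1] (nbhs (0 : R)), cdom cx (gamma s) := C0 _ (near_cdom cxx).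
have nD : \forall s \near within `[0, 1] (nbhs (0 : R)), cimg cx (cmap cx (gamma s)).
  by apply: filterS near0 => s cs; exists (gamma s).
have := has_deriv_within_comp_curve D0 D1 nD.
rewrite g0 => HH; apply: (has_deriv_within_curve_unique ltr01 _ Dt).
apply: has_deriv_within_near_eq HH.
  apply: filterS2 near0 (withinT _ _) => s nz s01.
  split => //; rewrite /f1 /= cmapK; last exact: nz.
  move: s01; rewrite /= in_itv /= => /andP[s0 s1].
  rewrite (@flow_shift s t x) // 1?addrC //.
  apply: integral_curve_sub H _ => u /=; rewrite !in_itv /= => /andP[-> us].
  by rewrite (le_trans us) ?lerD2l.
by rewrite /f1 /= g0 cmapK // gt addr0.
Qed.

End Flow.

(** Were [a] positive, then at time [(|B| + 1) / (a lambda)] the inequality [1 + y <= exp y] would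
    give [a + |B| + 1 <= B]. *)
Lemma exp_decay_le0 (R : realType) (a B lambda : R) : 0 < lambda ->
  (forall t, 0 < t -> a <= B * expR (- (lambda * t))) -> a <= 0.
Proof.
move=> l0 H; rewrite leNgt; apply/negP => a0.
have al : 0 < a * lambda by rewrite mulr_gt0.
have B1 : 0 < `|B| + 1 by rewrite ltr_wpDl.
have := H _ (divr_gt0 B1 al); set t := _ / _.
rewrite expRN ler_pdivlMr ?expR_gt0 // => H1.
have := expR_ge1Dx (lambda * t); rewrite -(ler_pM2l a0) => H2.
have E : a * (1 + lambda * t) = a + `|B| + 1 by rewrite /t; field; rewrite !gt_eqF.
have := ler_norm B; rewrite E in H2; lra.
Qed.

(** * Invariant sets avoid the boundary *)

Section InteriorPoints.
Variables (R : realType) (n : nat) (M : topologicalType).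
Hypothesis n_gt0 : (0 < n)%N.

Lemma first_coordE : exists i : 'I_n, forall v : 'rV[R]_n, first_coord v = v 0 i.
Proof. by exists (Ordinal n_gt0) => v; rewrite /first_coord insubT. Qed.

(** Near a point with positive first coordinate the half-space condition holds by itself, so the
    relatively open chart image is a neighborhood. *)
Lemma interior_chart (c : chart R n M) x : cdom c x ->
  0 < first_coord (cmap c x) -> nbhs (cmap c x) (cimg c).
Proof.
have [i fi] := first_coordE; rewrite fi => cx pos.
have [W oW WE] := cimg_open c; rewrite /cimg WE.
have [Wx _] : (W `&` @halfspace R n) (cmap c x) by rewrite -WE; exists x.
apply: filterI; first exact: open_nbhs_nbhs.
apply/near_normP; exists (cmap c x 0 i) => // y yx; rewrite /halfspace /= fi.
have := le_lt_trans (coord_norm_le _ 0 i) yx; rewrite !mxE ltr_norml => /andP[+ _].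
lra.
Qed.

Lemma first_coord_ge0 (c : chart R n M) x : cdom c x -> 0 <= first_coord (cmap c x).
Proof.
move=> cx; have [W oW WE] := cimg_open c.
suff [] : (W `&` @halfspace R n) (cmap c x) by [].
by rewrite -WE; exists x.
Qed.

Variables (S : smooth_structure R n M) (X : M -> 'rV[R]_n) (phi : R -> M -> M).
Variable Lambda : set M.
Hypothesis X_inward : inwardly_transverse S X.
Hypothesis Lambda_invariant : flow_invariant S X phi Lambda.

(* An inward field admits no backward orbit at a boundary point. *)
Lemma invariant_interior x : Lambda x ->
  nbhs (cmap (chart_at S x) x) (cimg (chart_at S x)).
Proof.
move=> Lx; set c := chart_at S x.
have cx : cdom c x := chart_at_dom S x.
have ac : atlas S c := chart_at_atlas S x.
apply: interior_chart => //; rewrite lt_def first_coord_ge0 // andbT.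
apply/eqP => fc0; have k0 := X_inward ac cx fc0.
have [i fi] := first_coordE; rewrite !fi in fc0 k0.
(* Invariance at time -1 gives [x] a backward orbit, defined on [[-1, 0]]. *)
have [gamma [H g0]] := (Lambda_invariant (-1)).1 _ Lx.
rewrite min_r ?lerN10 // max_l ?lerN10 // in H.
have I0 : `[-1, 0]%classic (0 : R) by rewrite /= in_itv /= lerN10 lexx.
have [C0 _] := H _ I0; rewrite g0 in C0.
have near0 : \forall s \near within `[-1, 0] (nbhs (0 : R)), cdom c (gamma s) :=
  C0 _ (near_cdom cx).
have D0 := integral_curve_chart H I0 ac; rewrite g0 in D0.
have /has_deriv_withinP D := D0 cx.
set k := (_ *m _) 0 i in k0.
(* With error [k / 2] per unit of time, the first coordinate at time [- s] is at most [- k s / 2],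
   outside the half-space. *)
have [d d0 Hd] := D _ (divr_gt0 k0 (ltr0n R 2)).
have [d' d'0 Hd'] := (@near_within_normP R R^o _ _ _).1 near0.
pose s : R := Num.min 1 (Num.min d d' / 2).
have s0 : 0 < s by rewrite lt_min ltr01 divr_gt0 // lt_min d0.
have sd : s < Num.min d d'.
  have : s <= Num.min d d' / 2 by rewrite /s ge_min lexx orbT.
  have : 0 < Num.min d d' by rewrite lt_min d0.
  lra.
move: sd; rewrite lt_min => /andP[sd sd'].
have Is : `[-1, 0]%classic (- s).
  by rewrite /= in_itv /= oppr_le0 (ltW s0) lerN2 /s ge_min lexx.
have ns : `|- s - 0| = s by rewrite subr0 normrN gtr0_norm.
have := Hd _ Is; rewrite ns => /(_ sd) B.
have := Hd' _ Is; rewrite [`|_|]ns => /(_ sd') cs.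
have := first_coord_ge0 cs; rewrite fi /=.
have := le_trans (coord_norm_le _ 0 i) B; rewrite !mxE (_ : \sum_j _ = k) /= ?g0 ?fc0 ?subr0; last by rewrite /k mxE.
rewrite ler_norml => /andP[_]; have := mulr_gt0 k0 s0.
move: (cmap c (gamma (- s)) 0 i) => z; lra.
Qed.

End InteriorPoints.

(** * Vanishing of the field on the invariant set *)

Section VanishingField.
Variables (R : realType) (n : nat) (M : topologicalType).
Variables (S : smooth_structure R n M) (g : M -> 'M[R]_n).
Variables (X : M -> 'rV[R]_n) (phi : R -> M -> M) (DX : R -> M -> 'M[R]_n).
Variables (Lambda : set M) (E F : M -> 'M[R]_n) (C lambda : R).
Hypothesis g_metric : riemannian_metric S g.
Hypothesis X_C1 : C1_vector_field S X.
Hypothesis Lambda_interior : forall x, Lambda x ->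
  nbhs (cmap (chart_at S x) x) (cimg (chart_at S x)).

Lemma field_has_deriv c x : atlas S c -> cdom c x ->
  exists A : 'M[R]_n, has_deriv_within (cimg c) (field_in_chart S X c) (cmap c x)
    (fun v => v *m A).
Proof.
move=> ac cx; have [df [Hdf _]] := X_C1 ac.
exists (lin1_mx (df (cmap c x))).
rewrite (_ : (fun v => _) = df (cmap c x)); first by apply: Hdf; exists x.
by apply/funext => v; rewrite mul_rV_lin1.
Qed.

Lemma trmx_norm_le m k (A : 'M[R]_(m, k)) : `|A^T| <= `|A|.
Proof.
rewrite [leLHS]/Num.norm /= mx_normrE; apply/bigmax_leP; split=> [//|[i j] _ /=].
by rewrite mxE coord_norm_le.
Qed.

(** The distinguished chart may change abruptly with [y]. In a fixed chart the field and the metric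
    are continuous, and the norm is unaffected since [to_chart] and [from_chart] cancel. *)
Lemma rnorm_chart c y : atlas S c -> cdom c y -> Lambda y ->
  rnorm g y (X y) = Num.sqrt ((field_in_chart S X c (cmap c y)
    *m metric_in_chart S g c (cmap c y)
    *m (field_in_chart S X c (cmap c y))^T) 0 0).
Proof.
move=> ac cy Ly; have TF := to_from_chart ac cy (Lambda_interior Ly).
rewrite /rnorm /field_in_chart /metric_in_chart cmapK // trmx_mul.
congr (Num.sqrt (_ 0 0)).
have -> : X y *m to_chart S c y *m (from_chart S c y *m g y *m (from_chart S c y)^T)
    *m ((to_chart S c y)^T *m (X y)^T)
  = X y *m (to_chart S c y *m from_chart S c y) *m g y
    *m (to_chart S c y *m from_chart S c y)^T *m (X y)^T.
  by rewrite trmx_mul !mulmxA.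
by rewrite TF trmx1 !mulmx1.
Qed.

Lemma field_locally_bounded x : Lambda x ->
  exists K : R, \forall y \near x, Lambda y -> rnorm g y (X y) <= K.
Proof.
move=> Lx; set c := chart_at S x.
have cx : cdom c x := chart_at_dom S x.
have ac : atlas S c := chart_at_atlas S x.
pose f := field_in_chart S X c; pose G := metric_in_chart S g c.
have [A HA] := field_has_deriv ac cx.
have Hf := has_deriv_within_continuous (mulmx_bounded_additive _) HA.
have ix : cimg c (cmap c x) by exists x.
have HG := (within_continuousP _ _).1 (rmetric_smooth g_metric ac 0%N) _ ix.
have nf : \forall z \near within (cimg c) (nbhs (cmap c x)), `|f z| <= `|f (cmap c x)| + 1.
  move/cvgrPdist_le: Hf => /(_ 1 ltr01); apply: filterS => z /= Hz.
  rewrite -lerBlDl; apply: le_trans Hz.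
  by rewrite distrC (le_trans _ (lerB_dist _ _)).
have nG : \forall z \near within (cimg c) (nbhs (cmap c x)), `|G z| <= `|G (cmap c x)| + 1.
  move/cvgrPdist_le: HG => /(_ 1 ltr01); apply: filterS => z /= Hz.
  rewrite -lerBlDl; apply: le_trans Hz.
  by rewrite distrC (le_trans _ (lerB_dist _ _)).
pose a := `|f (cmap c x)| + 1; pose b := `|G (cmap c x)| + 1.
exists (Num.sqrt (n%:R * (n%:R * a * b) * a)).
have nfG : \forall z \near within (cimg c) (nbhs (cmap c x)), `|f z| <= a /\ `|G z| <= b.
  by apply: filterS2 nf nG.
have icx : cmap c z @[z --> x] --> cmap c x.
  have := (within_continuousP _ _).1 (@cmap_continuous _ _ _ c) _ cx.
  by rewrite within_interior //; exact: near_cdom.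
rewrite near_withinE in nfG.
have nz : \forall y \near x, cimg c (cmap c y) -> `|f (cmap c y)| <= a /\ `|G (cmap c y)| <= b :=
  icx _ nfG.
apply: filterS2 nz (near_cdom cx) => y Hy cy Ly.
have [fa Gb] : `|f (cmap c y)| <= a /\ `|G (cmap c y)| <= b by apply: Hy; exists y.
rewrite (rnorm_chart ac cy Ly) -/f -/G ler_wsqrtr //.
apply: le_trans (ler_norm _) _; apply: le_trans (coord_norm_le _ _ _) _.
apply: le_trans (mulmx_norm_le _ _) _.
rewrite ler_pM ?mulr_ge0 //; last exact: le_trans (trmx_norm_le _) _.
rewrite ler_wpM2l //; apply: le_trans (mulmx_norm_le _ _) _.
by rewrite ler_pM ?mulr_ge0 // ler_wpM2l.
Qed.

Hypothesis Lambda_compact : compact Lambda.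

Lemma field_bounded : exists2 K : R, 0 <= K & forall x, Lambda x -> rnorm g x (X x) <= K.
Proof.
have nK : \forall K \near +oo, Lambda `<=` (fun x => Lambda x -> rnorm g x (X x) <= K).
  (* Near-covering compactness, with the filter of large [K], makes the local bounds uniform. *)
  apply: ((compact_near_coveringP _).1 Lambda_compact R +oo
    (fun K x => Lambda x -> rnorm g x (X x) <= K)) => x Lx.
  have [K HK] := field_locally_bounded Lx.
  exists ([set y | Lambda y -> rnorm g y (X y) <= K], [set k | K <= k]).
    by split => //=; apply: nbhs_pinfty_ge; exact: num_real.
  by move=> [y k] /= [Hy Kk] Ly; apply: le_trans Kk; exact: Hy.
have nK0 : \forall K \near +oo, (0 : R) <= K by apply: nbhs_pinfty_ge; exact: num_real.
have [K [K0 HK]] := filter_ex (filterI nK0 nK).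
by exists K => // x Lx; exact: HK.
Qed.

Hypothesis Lambda_invariant : flow_invariant S X phi Lambda.
Hypothesis phi_flow : flow_of S X phi.
Hypothesis DX_deriv : flow_derivative S X phi DX.
Hypothesis EF_splitting : continuous_splitting S Lambda E F.
Hypothesis F_invariant : invariant_subbundle phi DX Lambda F.
Hypothesis C_gt0 : 0 < C.
Hypothesis lambda_gt0 : 0 < lambda.
Hypothesis E_contracting : forall (x : M) (t : R), Lambda x -> 0 < t ->
  (opnorm_on g x (phi t x) (E x) (DX t x) <= (C * expR (- (lambda * t)))%:E)%E.
Hypothesis F_expanding : forall (x : M) (t : R), Lambda x -> 0 < t ->
  (opnorm_on g (phi t x) x (F (phi t x)) (DX (- t)%R (phi t x))
     <= (C * expR (- (lambda * t)))%:E)%E.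

Lemma invariant_flow x t : Lambda x -> Lambda (phi t x).
Proof. by move=> Lx; have [_ <-] := Lambda_invariant t; exists x. Qed.

Lemma splitting_sum x (v : 'rV[R]_n) : Lambda x ->
  exists u w, [/\ (u <= E x)%MS, (w <= F x)%MS & v = u + w].
Proof.
move=> Lx; have [_ _ /(_ _ Lx)[/eqmxP EF _]] := EF_splitting.
have : (v <= E x + F x)%MS by rewrite EF submx1.
move=> /sub_addsmxP[[a b] /= ->].
by exists (a *m E x), (b *m F x); rewrite !submxMl.
Qed.

(** With [X x = u + v], [u] in [E] and [v] in [F], the vector [DX_t v = X (X_t x) - DX_t u] is
    bounded by [K + C |u|] for all [t > 0]; [DX_(-t)] brings it back to [v] with a factor
    [C exp (- lambda t)]. *)
Lemma field_in_E x : Lambda x -> (X x <= E x)%MS.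
Proof.
move=> Lx; have [K K0 HK] := field_bounded.
have [u [v [uE vF Xuv]]] := splitting_sum (X x) Lx.
suff v0 : v = 0 by rewrite Xuv v0 addr0.
apply: (rnorm_le0 g_metric (x := x)).
apply: (@exp_decay_le0 _ _ (C * (K + C * rnorm g x u)) lambda) => // t t0.
have Ly := invariant_flow t Lx.
have vDF : (v *m DX t x <= F (phi t x))%MS.
  by have /andP[+ _] := F_invariant t Lx; apply: submx_trans; exact: submxMr.
have e1 : expR (- (lambda * t)) <= 1.
  by rewrite -expR0 ler_expR oppr_le0 mulr_ge0 ?ltW.
have e0 := expR_ge0 (- (lambda * t)).
have vE : v = v *m DX t x *m DX (- t) (phi t x).
  by rewrite -mulmxA (flow_derivative_inverse phi_flow DX_deriv (ltW t0)) ?mulmx1 //; exact: Lambda_interior.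
have B1 := rnorm_opnorm g_metric (F_expanding Lx t0) vDF.
have B2 := rnorm_opnorm g_metric (E_contracting Lx t0) uE.
have XE : v *m DX t x = X (phi t x) + - (u *m DX t x).
  by rewrite -(flow_derivative_field phi_flow DX_deriv _ (ltW t0)) Xuv mulmxDl addrC addKr.
have B3 : rnorm g (phi t x) (v *m DX t x) <= K + C * rnorm g x u.
  rewrite XE; apply: le_trans (rnormD g_metric _ _ _) _.
  rewrite (rnormN g_metric) lerD ?HK //; apply: le_trans B2 _.
  by rewrite ler_wpM2r ?rnorm_ge0 // ler_piMr // ltW.
rewrite {1}vE; apply: le_trans B1 _; rewrite mulrAC ler_wpM2r //.
by rewrite ler_wpM2l ?(ltW C_gt0).
Qed.

(** Each [x] in [Lambda] is [X_t y] with [y] in [Lambda], so [X x = DX_t (X y)] has norm at most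
    [C K exp (- lambda t)], for every [t > 0]. *)
Lemma field_vanishes x : Lambda x -> X x = 0.
Proof.
move=> Lx; have [K K0 HK] := field_bounded.
apply: (rnorm_le0 g_metric (x := x)).
apply: (@exp_decay_le0 _ _ (C * K) lambda) => // t t0.
have [_ E'] := Lambda_invariant t.
have [y Ly yx] : (phi t @` Lambda) x by rewrite E'.
rewrite -yx -(flow_derivative_field phi_flow DX_deriv _ (ltW t0)).
apply: le_trans (rnorm_opnorm g_metric (E_contracting Ly t0) (field_in_E Ly)) _.
rewrite mulrAC ler_wpM2r ?expR_ge0 // ler_wpM2l ?(ltW C_gt0) //.
exact: HK.
Qed.

End VanishingField.

(** * Linearization of the flow at a zero of the field *)

Section Singularity.
Variables (R : realType) (n : nat) (M : topologicalType).
Hypothesis M_hausdorff : hausdorff_space M.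
Variables (S : smooth_structure R n M) (X : M -> 'rV[R]_n) (sigma : M).
Let c := chart_at S sigma.
Let p := cmap c sigma.
Let f := field_in_chart S X c.
Variable A : 'M[R]_n.
Hypothesis X0 : X sigma = 0.
Hypothesis sigma_interior : nbhs p (cimg c).
Hypothesis f_deriv : has_deriv_within (cimg c) f p (fun v => v *m A).

Let c_sigma : cdom c sigma. Proof. exact: chart_at_dom. Qed.
Let c_atlas : atlas S c. Proof. exact: chart_at_atlas. Qed.

Let f0 : f p = 0.
Proof. by rewrite /f /field_in_chart cmapK // X0 mul0mx. Qed.

Let chart_curve tau gamma : integral_curve S X `[0, tau] gamma ->
  (forall s, 0 <= s <= tau -> cdom c (gamma s)) ->
  curve_derivative tau (fun s => cmap c (gamma s) - p) (fun s => f (cmap c (gamma s))).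
Proof.
move=> H Hc s sI; have cs : cdom c (gamma s) by apply: Hc; move: sI; rewrite /= in_itv.
have D := integral_curve_chart H sI c_atlas cs.
have -> : f (cmap c (gamma s)) = X (gamma s) *m to_chart S c (gamma s).
  by rewrite /f /field_in_chart cmapK.
move=> e /D; apply: filterS => y /=.
by rewrite opprB addrA subrK.
Qed.

Let tube (r : R) : set M := [set q | cdom c q /\ `|cmap c q - p| <= r].

(** The closed ball is compact in coordinates, and so is its image under [cinv], which is therefore
    closed in the Hausdorff space [M]. Closedness in [M], and not only in the chart, lets a curve be
    followed up to its exit time. *)
Let tube_closed r : (forall z, `|z - p| <= r -> cimg c z) -> closed (tube r).
Proof.
move=> Hr; apply: compact_closed => //.
pose B := [set z : 'rV[R]_n | `|z - p| <= r].
have -> : tube r = cinv c @` B.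
  apply/seteqP; split=> [q [cq qr]|_ [z zr <-]].
    by exists (cmap c q) => //; rewrite cmapK.
  by have [q cq qz] := Hr _ zr; rewrite -qz cmapK //; split => //; rewrite qz.
apply: continuous_compact.
  by apply: continuous_subspaceW (@cinv_continuous _ _ _ c) => z; exact: Hr.
apply: bounded_closed_compact.
  exists (r + `|p|); split; first exact: num_real.
  move=> x xr z /= zr; rewrite -(subrK p z) (le_trans (ler_normD _ _)) //.
  by rewrite (le_trans _ (ltW xr)) // lerD2r.
rewrite (_ : B = closed_ball_ Num.Def.normr p r); first exact: closed_closed_ball_.
by apply/seteqP; split=> z; rewrite /B /closed_ball_ /= distrC.
Qed.

Let tube_nbhs r q : cdom c q -> `|cmap c q - p| < r -> nbhs q (tube r).
Proof.
move=> cq qr.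
have icq : cmap c y @[y --> q] --> cmap c q.
  have := (within_continuousP _ _).1 (@cmap_continuous _ _ _ c) _ cq.
  by rewrite within_interior //; exact: near_cdom.
have r0 : 0 < r - `|cmap c q - p| by rewrite subr_gt0.
move/cvgrPdist_lt: icq => /(_ _ r0) /= H.
apply: filterS2 H (near_cdom cq) => y Hy cy; split => //.
rewrite -(subrK (cmap c q) (cmap c y)) -addrA (le_trans (ler_normD _ _)) //.
by rewrite distrC -lerBrDr ltW.
Qed.

(* An integral curve starting close to a zero of the field stays, up to a fixed
   time, in a chart ball: at the first exit time the Gronwall bound would still
   keep it strictly inside. *)
Lemma confinement t : 0 <= t -> exists2 K : R, 0 < K &
  forall r : R, 0 < r -> exists2 d : R, 0 < d &
    forall gamma, integral_curve S X `[0, t] gamma ->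
      cdom c (gamma 0) -> `|cmap c (gamma 0) - p| < d ->
      forall s, 0 <= s <= t ->
        [/\ cdom c (gamma s), `|cmap c (gamma s) - p| < r &
            `|cmap c (gamma s) - p| <= K * `|cmap c (gamma 0) - p|].
Proof.
move=> t0.
have [L L0 [dL dL0 HL]] := has_deriv_within_lip (mulmx_bounded_additive _) f_deriv.
have [di di0 Hi] := (near_normP _ _).1 sigma_interior.
pose K := n%:R * expR (n%:R * L * t) + 1.
have K0 : 0 < K by rewrite ltr_wpDl // mulr_ge0 // expR_ge0.
exists K => // r r0.
(* The ball of radius [q] lies in the chart image and where [L] bounds the field; the halves make
   the inequalities strict. *)
pose q := Num.min (r / 2) (Num.min dL di / 2).
have q0 : 0 < q by rewrite lt_min !divr_gt0 // lt_min dL0.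
have qr : q < r by have : q <= r / 2 by [rewrite /q ge_min lexx]; lra.
have qm : q < Num.min dL di.
  have : q <= Num.min dL di / 2 by rewrite /q ge_min lexx orbT.
  have : 0 < Num.min dL di by rewrite lt_min dL0.
  lra.
move: qm; rewrite lt_min => /andP[qL qi].
have qimg z : `|z - p| <= q -> cimg c z by move=> zq; apply: Hi; exact: le_lt_trans zq qi.
(* The Gronwall factor [K] cannot carry a start this close as far as [q]. *)
exists (Num.min q (q / K)); first by rewrite lt_min q0 divr_gt0.
move=> gamma H c0; rewrite lt_min => /andP[w0q w0K].
have w0K' : K * `|cmap c (gamma 0) - p| < q by rewrite mulrC -ltr_pdivlMr.
have bound tau : 0 <= tau <= t -> (forall s, 0 <= s <= tau -> tube q (gamma s)) ->
    `|cmap c (gamma tau) - p| <= K * `|cmap c (gamma 0) - p|.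
  move=> /andP[tau0 taut] Htau.
  have Hsub : integral_curve S X `[0, tau] gamma.
    apply: integral_curve_sub H _ => s /=; rewrite !in_itv /= => /andP[-> st].
    by rewrite (le_trans st).
  have D := chart_curve Hsub (fun s sI => (Htau s sI).1).
  have G := gronwall tau0 (ltW L0) D.
  apply: le_trans (G _) _.
    move=> s /Htau[cs sq].
    have := HL _ (qimg _ sq) (le_lt_trans sq qL).
    by rewrite f0 subr0.
  rewrite ler_wpM2r // /K -[leLHS]addr0 lerD // ler_wpM2l // ler_expR.
  by rewrite ler_wpM2l // mulr_ge0 // ltW.
have inside s : 0 <= s <= t -> tube q (gamma s).
  (* Otherwise [tau] below is the infimum of the times spent outside the tube. *)
  apply: contrapT => /not_implyP[s_t s_out].
  pose B := [set u | 0 <= u <= t /\ ~ tube q (gamma u)].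
  have Binf : has_inf B.
    by split; [exists s|exists 0 => u [/andP[]]].
  pose tau := inf B.
  have tau0 : 0 <= tau by apply: lb_le_inf; [exact: Binf.1|move=> u [/andP[]]].
  have taut : tau <= t.
    apply: (@le_trans _ _ s); last by case/andP: s_t.
    by apply: ge_inf => //; exact: Binf.2.
  have before u : 0 <= u < tau -> tube q (gamma u).
    move=> /andP[u0 utau]; apply: contrapT => uout.
    have : tau <= u.
      apply: ge_inf; first exact: Binf.2.
      by split => //; rewrite u0 (le_trans (ltW utau)).
    by rewrite leNgt utau.
  have at0 : tube q (gamma 0) by split => //; exact: ltW.
  have tauI : `[0, t]%classic tau by rewrite /= in_itv /= tau0.
  have [Ct _] := H _ tauI.
  have attau : tube q (gamma tau).
    (* If this failed, openness of the complement would put the curve outside at time [u] too; but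
       [u] is 0 or precedes [tau]. *)
    apply: contrapT => tauout.
    have nout : nbhs (gamma tau) (~` tube q).
      by apply: open_nbhs_nbhs; split => //; exact/closed_openC/tube_closed.
    have nU : \forall u \near within `[0, t] (nbhs tau), (~` tube q) (gamma u) := Ct _ nout.
    have [d d0 Hd] := (@near_within_normP R R^o _ _ _).1 nU.
    pose u := Num.max 0 (tau - d / 2).
    have u0 : 0 <= u by rewrite /u le_max lexx.
    have ut : u <= tau by rewrite /u ge_max tau0 /= gerBl divr_ge0 // ltW.
    have ud : `|u - tau| < d.
      rewrite distrC ger0_norm ?subr_ge0 //.
      have : tau - d / 2 <= u by rewrite /u le_max lexx orbT.
      lra.
    apply: (Hd u) => //; first by rewrite /= in_itv /= u0 (le_trans ut).
    have [/eqP u00|une] := boolP (u == 0); first by rewrite u00.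
    apply: before; rewrite u0 /=.
    move: une; rewrite /u; case: (leP 0 (tau - d / 2)) => [_ _|_]; last by rewrite eqxx.
    lra.
  have Htau u : 0 <= u <= tau -> tube q (gamma u).
    move=> /andP[u0]; rewrite le_eqVlt => /predU1P[->//|utau].
    by apply: before; rewrite u0.
  have tau_t : 0 <= tau <= t by rewrite tau0.
  (* The bound is strict at [tau], so the curve is in the tube at all times within some [d] of
     [tau], although one of the outside times is that close. *)
  have wtau : `|cmap c (gamma tau) - p| < q := le_lt_trans (bound _ tau_t Htau) w0K'.
  have nU : \forall u \near within `[0, t] (nbhs tau), tube q (gamma u) :=
    Ct _ (tube_nbhs attau.1 wtau).
  have [d d0 Hd] := (@near_within_normP R R^o _ _ _).1 nU.
  have [b [b_t bout] btau] := inf_adherent d0 Binf.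
  have taub : tau <= b by apply: ge_inf; [exact: Binf.2|split].
  apply: bout; apply: Hd; first by rewrite /= in_itv.
  rewrite [`|_|]ger0_norm ?subr_ge0 // ltrBlDl; exact: btau.
move=> s s_t; have [cs sq] := inside _ s_t; split => //.
  exact: le_lt_trans sq qr.
apply: bound => // u /andP[u0 us]; apply: inside; rewrite u0 /=.
by rewrite (le_trans us) //; case/andP: s_t.
Qed.

Variables (phi : R -> M -> M) (DX : R -> M -> 'M[R]_n).
Hypothesis phi_flow : flow_of S X phi.
Hypothesis DX_deriv : flow_derivative S X phi DX.

(* Along the flow, [cos (beta s) a + sin (beta s) b] evaluated at the
   displacement from [sigma] is constant up to the linearization error. *)
Lemma flow_derivative_rotation (a b : 'cV[R]_n) (beta t : R) : 0 <= t ->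
  A *m a = - beta *: b -> A *m b = beta *: a ->
  DX t sigma *m (cos (beta * t) *: a + sin (beta * t) *: b) = a.
Proof.
move=> t0 Aa Ab.
pose rot s := cos (beta * s) *: a + sin (beta * s) *: b.
rewrite -/(rot t); apply/row_matrixP => i; rewrite !rowE mulmxA.
set v : 'rV[R]_n := delta_mx 0 i.
pose m := `|a| + `|b|.
have m0 : 0 <= m by rewrite addr_ge0.
have rot_le s : `|rot s| <= m.
  apply: le_trans (ler_normD _ _) _; rewrite !normrZ lerD //.
    by rewrite ler_piMl // ler_norml cos_geN1 cos_le1.
  by rewrite ler_piMl // ler_norml sin_geN1 sin_le1.
have [K K0 HK] := confinement t0.
(* The first summand is the linearization error along the orbit up to time [t], the second the error
   of differentiating [X_t] at [sigma]; both are per unit of [e] and of the step [h]. *)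
pose Q := n%:R * (K * `|v|) * m * t + n%:R * `|v| * m.
have Q0 : 0 <= Q by rewrite addr_ge0 // ?mulr_ge0 // ltW.
suff small e : 0 < e -> `|v *m DX t sigma *m rot t - v *m a| <= e * Q.
  apply/eqP; rewrite -subr_eq0 -normr_le0; apply/ler_addgt0Pl => e e0.
  rewrite addr0; have Q1 : 0 < Q + 1 by rewrite ltr_wpDl.
  apply: le_trans (small _ (divr_gt0 e0 Q1)) _.
  by rewrite -mulrA ler_piMr ?ltW // mulrC ltr_pdivrMr // mul1r ltrDl.
move=> e0.
have [r r0 Hr] := (has_deriv_withinP _ _ _ _).1 f_deriv _ e0.
have [d1 d10 Hd1] := HK _ r0.
have [_ DD] := DX_deriv (phi_flow.1 t sigma t0).
have fixs := flow_fixed phi_flow t X0.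
rewrite fixs -/c in DD.
have [d2 d20 Hd2] := (has_deriv_withinP _ _ _ _).1 DD _ e0.
have [d3 d30 Hd3] := (near_normP _ _).1 sigma_interior.
pose dm := Num.min d1 (Num.min d2 d3).
have dm0 : 0 < dm by rewrite !lt_min d10 d20.
(* The step is scaled so that [p + h *: v] lies within all three radii of [p]. *)
pose h := dm / (`|v| + 1).
have v1 : 0 < `|v| + 1 by rewrite ltr_wpDl.
have h0 : 0 < h by rewrite divr_gt0.
have hv : `|h *: v| < dm.
  rewrite normrZ gtr0_norm // /h mulrAC -mulrA gtr_pMr //.
  by rewrite ltr_pdivrMr // mul1r ltrDl.
pose z := p + h *: v.
have zp : z - p = h *: v by rewrite /z addrC addKr.
move: hv; rewrite -zp !lt_min => /and3P[z1 z2 z3].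
have [y cy yz] := Hd3 _ z3.
have [gamma [H g0 Hg]] := flow_curve phi_flow y t0.
have gt : phi t y = gamma t by rewrite Hg // t0 lexx.
rewrite -yz -g0 in z1.
have Hs := Hd1 _ H (eq_ind_r (cdom c) cy g0) z1.
rewrite g0 yz zp in Hs.
pose w s := cmap c (gamma s) - p.
have w0 : w 0 = h *: v by rewrite /w g0 yz zp.
have D : curve_derivative t w (fun s => f (cmap c (gamma s))).
  by apply: chart_curve H _ => s /Hs[].
pose P s := (w s *m rot s) 0 0.
(* By the relations between [A], [a] and [b], the derivative of [rot] is [- A *m rot], so the linear
   part of [f] cancels in the derivative of [P]. *)
pose dP s := ((f (cmap c (gamma s)) - w s *m A) *m rot s) 0 0.
have PE : P = (fun s => cos (beta * s) * (w s *m a) 0 0 + sin (beta * s) * (w s *m b) 0 0).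
  by apply/funext => s; rewrite /P /rot mulmxDr -!scalemxAr 3!mxE [in X in _ + X]mxE.
have dPE s : dP s = cos (beta * s) * (f (cmap c (gamma s)) *m a) 0 0
    + sin (beta * s) * (f (cmap c (gamma s)) *m b) 0 0
    + beta * (cos (beta * s) * (w s *m b) 0 0 - sin (beta * s) * (w s *m a) 0 0).
  rewrite /dP mulmxBl -(mulmxA (w s)) /rot !mulmxDr -!scalemxAr Aa Ab -!scalemxAr.
  move: (_ *m a) (_ *m b) (w s *m a) (w s *m b).
  by move=> x1 x2 x3 x4; rewrite !mxE; ring.
have [s st|s sI|s st E] := @is_derive_within_mvt R t P dP t0.
- have Da := curve_coord_is_derive a st D.
  have Db := curve_coord_is_derive b st D.
  pose wa x := (w x *m a) 0 0; pose wb x := (w x *m b) 0 0.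
  rewrite -/wa in Da; rewrite -/wb in Db.
  have -> : P = (cos \o ( *%R beta)) * wa + (sin \o ( *%R beta)) * wb.
    by rewrite PE; apply/funext.
  apply: is_derive_eq; rewrite dPE /GRing.scale /= -/(wa s) -/(wb s).
  by rewrite !mulr1; ring.
- rewrite PE; apply: cvgD; apply: cvgM; try exact: curve_coord_continuous D _ sI.
  + apply: cvg_within_filter; apply: continuous_cvg; first exact: continuous_cos.
    by apply: cvgM; [exact: cvg_cst|exact: cvg_id].
  + apply: cvg_within_filter; apply: continuous_cvg; first exact: continuous_sin.
    by apply: cvgM; [exact: cvg_cst|exact: cvg_id].
have err (u : 'rV[R]_n) x s' k : `|u| <= e * k -> x = (u *m rot s') 0 0 ->
    `|x| <= e * (n%:R * k * m).
  move=> uk ->; apply: le_trans (coord_norm_le _ _ _) _.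
  apply: le_trans (mulmx_norm_le _ _) _.
  apply: le_trans (_ : n%:R * (e * k) * m <= _).
    by rewrite ler_pM ?mulr_ge0 // ler_wpM2l.
  by rewrite le_eqVlt; apply/orP; left; apply/eqP; ring.
have hvE : `|h *: v| = h * `|v| by rewrite normrZ gtr0_norm.
have dPs : `|dP s| <= e * (n%:R * (h * (K * `|v|)) * m).
  apply: err (erefl _); have [cs sr sK] := Hs _ st.
  have := Hr _ _ sr; rewrite f0 subr0 => /(_ (ex_intro2 _ _ _ cs erefl)).
  move=> /le_trans; apply; rewrite ler_pM2l //; apply: le_trans sK _.
  by rewrite hvE mulrCA.
have P0 : P 0 = h * (v *m a) 0 0.
  by rewrite /P w0 /rot mulr0 cos0 sin0 scale0r addr0 scale1r -scalemxAl mxE.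
have Pt : `|P t - h * (v *m DX t sigma *m rot t) 0 0| <= e * (n%:R * (h * `|v|) * m).
  apply: (err (w t - h *: (v *m DX t sigma)) _ t); last first.
    by rewrite mulmxBl -scalemxAl [RHS]mxE; congr (_ + _); rewrite [RHS]mxE [X in _ = - X]mxE.
  have zI : (cmap c @` (cdom c `&` flow_dom S X t)) z.
    by exists y; [split; [exact: cy|exact: (phi_flow.1 _ _ t0)]|exact: yz].
  have zK : cinv c z = y by rewrite -yz cmapK.
  have pK : cinv c p = sigma by rewrite cmapK.
  by have := Hd2 _ zI z2; rewrite /= zK pK fixs gt zp hvE -scalemxAl.
have E1 : `|P t - P 0| <= e * (n%:R * (h * (K * `|v|)) * m) * t.
  by rewrite E normrM (ger0_norm t0) ler_wpM2r.
have scalar_norm (B : 'M[R]_1) : `|B| = `|B 0 0|.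
  apply/le_anti; rewrite coord_norm_le andbT [leLHS]/Num.norm /= mx_normrE.
  by apply/bigmax_leP; split => // -[i' j'] _ /=; rewrite !ord1.
rewrite scalar_norm [X in `|X|]mxE [X in _ + X]mxE -(ler_pM2l h0).
rewrite -[X in X * `|_|](gtr0_norm h0) -normrM.
move: Pt E1; rewrite P0 => Pt E1.
set x := (v *m a) 0 0 in E1 *; set y' := (_ *m rot t) 0 0 in Pt *.
have -> : h * (y' - x) = (P t - h * x) - (P t - h * y') by ring.
apply: le_trans (ler_normB _ _) _; apply: le_trans (lerD E1 Pt) _.
by rewrite le_eqVlt; apply/orP; left; apply/eqP; rewrite /Q; ring.
Qed.

End Singularity.

(** * Imaginary eigenvalues, discrete compact sets and isolated zeros *)

Lemma imaginary_eigenvector (R : realType) (n : nat) (A : 'M[R]_n) (z : R[i]) :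
  eigenvalue (map_mx (real_complex R) A) z -> complex.Re z = 0 ->
  exists a b : 'cV[R]_n, [/\ A *m a = - complex.Im z *: b,
    A *m b = complex.Im z *: a & a != 0 \/ b != 0].
Proof.
move=> ez Rez.
(* [eigenvalue] concerns row vectors; transposing the singular matrix gives a column eigenvector,
   that is, a complex linear functional on row vectors. *)
have [v v0 Av] : exists2 v : 'rV[R[i]]_n, v != 0 &
    (map_mx (real_complex R) A) *m v^T = z *: v^T.
  move: ez; rewrite /eigenvalue /eigenspace kermx_eq0 row_free_unit -unitmx_tr.
  rewrite -row_free_unit -kermx_eq0 => /rowV0Pn[v /sub_kermxP vA v0].
  exists v => //; apply: (can_inj (@trmxK _ _ _)); apply/eqP.
  rewrite -subr_eq0 trmx_mul trmxK linearZ /= trmxK -mul_mx_scalar -mulmxBr.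
  by rewrite -[z%:M]tr_scalar_mx -linearB /= vA.
pose re (w : R[i]) := complex.Re w; pose im (w : R[i]) := complex.Im w.
(* The two relations are the real and imaginary parts of [A (a + i b) = i beta (a + i b)], with
   [beta] the imaginary part of [z]. *)
exists (\col_i re (v 0 i)), (\col_i im (v 0 i)).
have reD : {morph re : x y / x + y} by case=> [x1 x2] [y1 y2].
have imD : {morph im : x y / x + y} by case=> [x1 x2] [y1 y2].
have Ai i : \sum_j (A i j)%:C%C * v 0 j = z * v 0 i.
  have := congr1 (fun B : 'cV_n => B i 0) Av; rewrite mxE [X in _ = X]mxE mxE => <-.
  by apply: eq_bigr => j _; rewrite !mxE.
have zE : z = Complex 0 (complex.Im z) by case: (z) Rez => x y /= ->.
split.
- apply/matrixP => i j; rewrite !mxE.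
  have := congr1 re (Ai i); rewrite (big_morph re reD (erefl : re 0 = 0)) => E.
  transitivity (\sum_k re ((A i k)%:C%C * v 0 k)).
    by apply: eq_bigr => k _; rewrite !mxE /re; case: (v 0 k) => x y /=; ring.
  by rewrite E zE /re /im; case: (v 0 i) => x y /=; ring.
- apply/matrixP => i j; rewrite !mxE.
  have := congr1 im (Ai i); rewrite (big_morph im imD (erefl : im 0 = 0)) => E.
  transitivity (\sum_k im ((A i k)%:C%C * v 0 k)).
    by apply: eq_bigr => k _; rewrite !mxE /im; case: (v 0 k) => x y /=; ring.
  by rewrite E zE /re /im; case: (v 0 i) => x y /=; ring.
- apply/orP; rewrite -negb_and; apply: contra v0 => /andP[/eqP a0 /eqP b0].
  apply/eqP/rowP => i; rewrite mxE.
  have := congr1 (fun B : 'cV_n => B i 0) a0; have := congr1 (fun B : 'cV_n => B i 0) b0.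
  by rewrite !mxE /re /im; case: (v 0 i) => x y /= -> ->.
Qed.

(** Near-covering compactness is applied to the finite sets directed by inclusion: every finite set
    containing [x] contains all points of [D] near [x], so a single finite set contains all of
    [D]. *)
Lemma isolated_points_finite (T : topologicalType) (D : set T) :
  compact D -> (forall x, D x -> \forall y \near x, D y -> y = x) -> finite_set D.
Proof.
move=> /compact_near_coveringP Dcov iso.
pose F : set_system (set T) := filter_from finite_set
  (fun B => [set B' | finite_set B' /\ B `<=` B']).
have FF : Filter F.
  apply: filter_from_filter; first by exists set0; exact: finite_set0.
  move=> B1 B2 f1 f2; exists (B1 `|` B2); first by rewrite finite_setU.
  move=> B [fB BB]; split; split => // x Bx; apply: BB; [by left|by right].
have [B fB HB] : F (fun B => D `<=` (fun x => D x -> B x)).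
  apply: (Dcov _ F (fun (B : set T) x => D x -> B x) FF) => x Dx.
  exists ([set y | D y -> y = x], [set B | finite_set B /\ [set x] `<=` B]).
    split; [exact: iso|exists [set x] => //; exact: finite_set1].
  by move=> [y B] /= [yx [_ xB]] Dy; rewrite (yx Dy); exact: xB.
by apply: (sub_finite_set _ (fB)) => x Dx; exact: (HB B (conj fB (subset_refl _)) x Dx Dx).
Qed.

(** A zero [z] close to [p] satisfies [|(z - p) A| <= |z - p| / k], while inverting [A] gives
    [|z - p| <= (k - 1) |(z - p) A|]; together they force [z = p]. *)
Lemma invertible_derivative_isolates (R : realType) (n : nat) (D : set 'rV[R]_n)
    (f : 'rV[R]_n -> 'rV[R]_n) (p : 'rV[R]_n) (A : 'M[R]_n) :
  A \in unitmx -> f p = 0 -> has_deriv_within D f p (fun v => v *m A) ->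
  exists2 d : R, 0 < d & forall z, D z -> `|z - p| < d -> f z = 0 -> z = p.
Proof.
move=> uA fp Hf; pose k := n%:R * `|invmx A| + 1.
have k0 : 0 < k by rewrite ltr_wpDl // mulr_ge0.
have [d d0 Hd] := (has_deriv_withinP _ _ _ _).1 Hf _ (divr_gt0 ltr01 k0).
exists d => // z Dz zd fz; apply/eqP; rewrite -subr_eq0 -normr_le0.
have := Hd _ Dz zd; rewrite fz fp subrr sub0r normrN => B.
have := mulmx_norm_le ((z - p) *m A) (invmx A); rewrite mulmxK //.
have w0 := normr_ge0 (z - p).
rewrite mulrAC => B2.
have : `|z - p| <= n%:R * `|invmx A| * (1 / k * `|z - p|).
  by apply: le_trans B2 _; rewrite ler_wpM2l // mulr_ge0.
rewrite mulrA mulrA mulr1 -subr_le0.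
have -> : `|z - p| - n%:R * `|invmx A| / k * `|z - p| = `|z - p| / k.
  by rewrite /k; field; rewrite gt_eqF.
by rewrite pmulr_lle0 // invr_gt0.
Qed.

(** * Hyperbolicity of the zeros *)

Section Hyperbolicity.
Variables (R : realType) (n : nat) (M : topologicalType).
Hypothesis M_hausdorff : hausdorff_space M.
Variables (S : smooth_structure R n M) (g : M -> 'M[R]_n).
Variables (X : M -> 'rV[R]_n) (phi : R -> M -> M) (DX : R -> M -> 'M[R]_n).
Variables (E F : 'M[R]_n) (C lambda : R) (sigma : M) (A : 'M[R]_n).
Hypothesis g_metric : riemannian_metric S g.
Hypothesis phi_flow : flow_of S X phi.
Hypothesis DX_deriv : flow_derivative S X phi DX.
Hypothesis lambda_gt0 : 0 < lambda.
Hypothesis X0 : X sigma = 0.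
Hypothesis sigma_interior :
  nbhs (cmap (chart_at S sigma) sigma) (cimg (chart_at S sigma)).
Hypothesis f_deriv : has_deriv_within (cimg (chart_at S sigma))
  (field_in_chart S X (chart_at S sigma)) (cmap (chart_at S sigma) sigma)
  (fun v => v *m A).
Hypothesis EF_sum : forall v : 'rV[R]_n,
  exists u w, [/\ (u <= E)%MS, (w <= F)%MS & v = u + w].
Hypothesis E_contracting : forall t, 0 < t ->
  (opnorm_on g sigma sigma E (DX t sigma) <= (C * expR (- (lambda * t)))%:E)%E.
Hypothesis F_expanding : forall t, 0 < t ->
  (opnorm_on g sigma sigma F (DX (- t) sigma) <= (C * expR (- (lambda * t)))%:E)%E.

(** The value of [a] at [v] is a bounded combination of the values of [a] and [b] at [v *m B t],
    whose norm decays. This serves both [E] under [DX_t] and [F] under [DX_(-t)]. *)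
Let decaying (W : 'M[R]_n) (B : R -> 'M[R]_n) (a b : 'cV[R]_n) (k k' : R -> R) (v : 'rV[R]_n) :
  (forall t, 0 < t -> (opnorm_on g sigma sigma W (B t)
     <= (C * expR (- (lambda * t)))%:E)%E) ->
  (forall t, `|k t| <= 1) -> (forall t, `|k' t| <= 1) ->
  (forall t, 0 < t -> a = B t *m (k t *: a + k' t *: b)) ->
  (v <= W)%MS -> (v *m a) 0 0 = 0.
Proof.
move=> HB k1 k'1 Ha vW.
have [Ka Ka0 HKa] := rnorm_functional g_metric sigma a.
have [Kb Kb0 HKb] := rnorm_functional g_metric sigma b.
apply/eqP; rewrite -normr_le0.
apply: (@exp_decay_le0 _ _ ((Ka + Kb) * (C * rnorm g sigma v)) lambda) => // t t0.
rewrite (Ha t t0) mulmxA mulmxDr -!scalemxAr mxE [X in `|X + _|]mxE [X in `|_ + X|]mxE.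
have Bv := rnorm_opnorm g_metric (HB t t0) vW.
apply: le_trans (ler_normD _ _) _; rewrite !normrM.
have -> : (Ka + Kb) * (C * rnorm g sigma v) * expR (- (lambda * t))
   = Ka * (C * expR (- (lambda * t)) * rnorm g sigma v)
   + Kb * (C * expR (- (lambda * t)) * rnorm g sigma v) by ring.
apply: lerD.
  apply: (@le_trans _ _ `|(v *m B t *m a) 0 0|); first by rewrite ler_piMl.
  by apply: le_trans (HKa _) _; rewrite ler_wpM2l.
apply: (@le_trans _ _ `|(v *m B t *m b) 0 0|); first by rewrite ler_piMl.
by apply: le_trans (HKb _) _; rewrite ler_wpM2l.
Qed.

Lemma no_oscillation (a b : 'cV[R]_n) (beta : R) :
  A *m a = - beta *: b -> A *m b = beta *: a -> a = 0.
Proof.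
move=> Aa Ab.
have rot_a t : 0 <= t -> DX t sigma *m (cos (beta * t) *: a + sin (beta * t) *: b) = a.
  move=> t0.
  exact: (flow_derivative_rotation M_hausdorff X0 sigma_interior f_deriv phi_flow DX_deriv t0).
(* The pair [(b, - a)] satisfies the same relations as [(a, b)]. *)
have rot_b t : 0 <= t -> DX t sigma *m (cos (beta * t) *: b - sin (beta * t) *: a) = b.
  move=> t0; rewrite -scalerN.
  apply: (flow_derivative_rotation M_hausdorff X0 sigma_interior f_deriv phi_flow DX_deriv t0).
    by rewrite Ab scalerN scaleNr opprK.
  by rewrite mulmxN Aa scaleNr opprK.
have inv t : 0 <= t -> DX (- t) sigma *m DX t sigma = 1%:M.
  move=> t0; apply: mulmx1C.
  by have := flow_derivative_inverse phi_flow DX_deriv t0 sigma_interior;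
    rewrite (flow_fixed phi_flow).
have cos1 t : `|cos (beta * t)| <= 1 by rewrite ler_norml cos_geN1 cos_le1.
have sin1 t : `|sin (beta * t)| <= 1 by rewrite ler_norml sin_geN1 sin_le1.
suff va0 (v : 'rV[R]_n) : (v *m a) 0 0 = 0.
  by apply/colP => i; have := va0 (delta_mx 0 i); rewrite -rowE !mxE.
have [u [w [uE wF ->]]] := EF_sum v.
rewrite mulmxDl mxE.
rewrite (@decaying E (fun t => DX t sigma) a b (fun t => cos (beta * t))
  (fun t => sin (beta * t)) u) //; last by move=> t /ltW t0; rewrite rot_a.
(* Backward in time the rotation turns the other way, hence [- b]. *)
rewrite add0r; apply: (@decaying F (fun t => DX (- t) sigma) a (- b) (fun t => cos (beta * t))
  (fun t => sin (beta * t)) w) => // t /ltW t0.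
have Da : DX (- t) sigma *m a = cos (beta * t) *: a + sin (beta * t) *: b.
  by rewrite -{1}(rot_a t t0) mulmxA inv // mul1mx.
have Db : DX (- t) sigma *m b = cos (beta * t) *: b - sin (beta * t) *: a.
  by rewrite -{1}(rot_b t t0) mulmxA inv // mul1mx.
rewrite mulmxDr -!scalemxAr mulmxN Da Db.
have := cos2Dsin2 (beta * t); move: (cos _) (sin _) => x y xy.
apply/colP => i; rewrite !mxE.
transitivity ((x ^+ 2 + y ^+ 2) * a i 0); first by rewrite xy mul1r.
by ring.
Qed.

Lemma hyperbolic_derivative (z : R[i]) :
  eigenvalue (map_mx (real_complex R) A) z -> complex.Re z != 0.
Proof.
move=> ez; apply/eqP => /(imaginary_eigenvector ez)[a [b [Aa Ab]]].
have a0 := no_oscillation Aa Ab.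
have b0 : b = 0.
  apply: (@no_oscillation b (- a) (complex.Im z)).
    by rewrite Ab scalerN scaleNr opprK.
  by rewrite mulmxN Aa scaleNr opprK.
by rewrite a0 b0 eqxx => -[].
Qed.

(** A singular [A] would have the eigenvalue 0, which lies on the imaginary axis. *)
Lemma hyperbolic_derivative_unit : A \in unitmx.
Proof.
rewrite -(map_unitmx (real_complex R)) -row_free_unit -kermx_eq0.
apply: contraT => K.
have := @hyperbolic_derivative 0; rewrite eqxx; apply.
by rewrite /eigenvalue /eigenspace raddf0 subr0.
Qed.

End Hyperbolicity.

(** * Zeros of the field on [Lambda]: hyperbolic, isolated, finite in number *)

Theorem theorem2p4 (R : realType) (n : nat) (M : topologicalType)
    (S : smooth_structure R n M) (g : M -> 'M[R]_n)
    (X : M -> 'rV[R]_n) (phi : R -> M -> M) (DX : R -> M -> 'M[R]_n)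
    (Lambda : set M) (E F : M -> 'M[R]_n) (C lambda : R)
    (n_ge3 : (3 <= n)%N)
    (M_compact : compact [set: M])
    (M_hausdorff : hausdorff_space M)
    (M_connected : connected [set: M])
    (g_metric : riemannian_metric S g)
    (X_C1 : C1_vector_field S X)
    (X_inward : inwardly_transverse S X)
    (phi_flow : flow_of S X phi)
    (DX_deriv : flow_derivative S X phi DX)
    (Lambda_compact : compact Lambda)
    (Lambda_invariant : flow_invariant S X phi Lambda)
    (EF_splitting : continuous_splitting S Lambda E F)
    (E_invariant : invariant_subbundle phi DX Lambda E)
    (F_invariant : invariant_subbundle phi DX Lambda F)
    (C_gt0 : 0 < C) (lambda_gt0 : 0 < lambda)
    (E_contracting : forall (x : M) (t : R), Lambda x -> 0 < t ->
       (opnorm_on g x (phi t x) (E x) (DX t x)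
          <= (C * expR (- (lambda * t)))%:E)%E)
    (F_expanding : forall (x : M) (t : R), Lambda x -> 0 < t ->
       (opnorm_on g (phi t x) x (F (phi t x)) (DX (- t)%R (phi t x))
          <= (C * expR (- (lambda * t)))%:E)%E) :
  finite_set Lambda /\
  forall sigma, Lambda sigma -> hyperbolic_singularity S X sigma.
Proof.
have Lint x : Lambda x -> nbhs (cmap (chart_at S x) x) (cimg (chart_at S x)).
  by apply: invariant_interior X_inward Lambda_invariant x; exact: leq_trans n_ge3.
have XL x : Lambda x -> X x = 0.
  exact: (field_vanishes g_metric X_C1 Lint Lambda_compact Lambda_invariant phi_flow
    DX_deriv EF_splitting F_invariant C_gt0 lambda_gt0 E_contracting F_expanding).
have fixL t x : Lambda x -> phi t x = x by move=> Lx; exact: (flow_fixed phi_flow t (XL _ Lx)).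
pose A x := field_derivative S X x.
have A_deriv x : Lambda x -> has_deriv_within (cimg (chart_at S x))
    (field_in_chart S X (chart_at S x)) (cmap (chart_at S x) x) (fun v => v *m A x).
  (* A derivative exists because the field is [C^1], so [xget] returns one and not its default 0. *)
  move=> Lx; rewrite /A /field_derivative /jacobian_within.
  have [B HB] := field_has_deriv X_C1 (chart_at_atlas S x) (chart_at_dom S x).
  exact: (@xgetPex _ 0 [set L | has_deriv_within (cimg (chart_at S x))
    (field_in_chart S X (chart_at S x)) (cmap (chart_at S x) x)
    (fun v => v *m L)]) (ex_intro _ B HB).
have EL x : Lambda x -> forall t, 0 < t ->
    (opnorm_on g x x (E x) (DX t x) <= (C * expR (- (lambda * t)))%:E)%E.
  by move=> Lx t t0; have := E_contracting x t Lx t0; rewrite fixL //.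
have FL x : Lambda x -> forall t, 0 < t ->
    (opnorm_on g x x (F x) (DX (- t)%R x) <= (C * expR (- (lambda * t)))%:E)%E.
  by move=> Lx t t0; have := F_expanding x t Lx t0; rewrite fixL //.
have sumL x : Lambda x -> forall v : 'rV[R]_n,
    exists u w, [/\ (u <= E x)%MS, (w <= F x)%MS & v = u + w].
  by move=> Lx v; exact: (splitting_sum EF_splitting).
split; last first.
  move=> x Lx; split; first exact: XL.
  move=> z; exact: (hyperbolic_derivative M_hausdorff g_metric phi_flow DX_deriv
    lambda_gt0 (XL _ Lx) (Lint _ Lx) (A_deriv _ Lx) (sumL _ Lx) (EL _ Lx) (FL _ Lx)).
(* Points of [Lambda] near [x] are zeros of the field in the chart at [x], where the invertible
   derivative isolates [cmap c x]; injectivity of the chart then identifies them with [x]. *)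
apply: isolated_points_finite Lambda_compact _ => x Lx.
have uA : A x \in unitmx := hyperbolic_derivative_unit M_hausdorff g_metric phi_flow
  DX_deriv lambda_gt0 (XL _ Lx) (Lint _ Lx) (A_deriv _ Lx) (sumL _ Lx) (EL _ Lx) (FL _ Lx).
set c := chart_at S x; have cx : cdom c x := chart_at_dom S x.
have f0 y : cdom c y -> Lambda y -> field_in_chart S X c (cmap c y) = 0.
  by move=> cy Ly; rewrite /field_in_chart cmapK // XL // mul0mx.
have [d d0 Hd] := invertible_derivative_isolates uA (f0 x cx Lx) (A_deriv x Lx).
have icx : cmap c y @[y --> x] --> cmap c x.
  have := (within_continuousP _ _).1 (@cmap_continuous _ _ _ c) _ cx.
  by rewrite within_interior //; exact: near_cdom.
move/cvgrPdist_lt: icx => /(_ _ d0) near_d.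
apply: filterS2 near_d (near_cdom cx) => y yd cy Ly.
have cyx : cmap c y = cmap c x.
  by apply: Hd; [exists y|rewrite distrC|exact: f0].
by rewrite -(cmapK cy) cyx cmapK.
Qed.
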